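(* Let $t_0<t_{\mathrm f}$, let $f:[t_0,t_{\mathrm f}]\times\mathbb{R}^n\to\mathbb{R}^n$ be piecewise polynomial in $t$ and polynomial in $x$, and consider the system $\dot x(t)=f(t,x(t))$. Let $\mathcal{G}=\{x\in\mathbb{R}^n : x'P_{\mathrm G}x\le 1\}$, where $P_{\mathrm G}\in\mathbb{R}^{n\times n}$ is symmetric positive definite. Let $\tau\in[t_0,t_{\mathrm f})$ and let $x_0:[\tau,t_{\mathrm f}]\to\mathbb{R}^n$ be a solution of the system with $x_{\mathrm f}:=x_0(t_{\mathrm f})\in\operatorname{int}(\mathcal{G})$. Let $P_{\mathrm f}$ be a symmetric positive definite matrix such that $\mathcal{E}_{\mathrm f}=\{x : (x-x_{\mathrm f})'P_{\mathrm f}(x-x_{\mathrm f})\le 1\}$ is the largest-volume ellipsoid centered at $x_{\mathrm f}$ that is contained in $\mathcal{G}$. Let $A(t)=\frac{\partial f}{\partial x}(t,x_0(t))$ for $t\in[\tau,t_{\mathrm f}]$, let $Q:[\tau,t_{\mathrm f}]\to\mathbb{S}^n_+$, and let $P_0^\star$ be a solution on $[\tau,t_{\mathrm f}]$ of the Lyapunov differential equation $$-\dot P_0^\star(t)=A(t)'P_0^\star(t)+P_0^\star(t)A(t)+Q(t),\qquad P_0^\star(t_{\mathrm f})=P_{\mathrm f}.$$ Then there exists a constant $c>0$ such that, with $$P^\star(t)=\exp\!\left(c\,\frac{t_{\mathrm f}-t}{t_{\mathrm f}-\tau}\right)P_0^\star(t),\qquad V^\star(t,x)=(x-x_0(t))'P^\star(t)(x-x_0(t)),$$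 the following hold. (1) $V^\star:[\tau,t_{\mathrm f}]\times\mathbb{R}^n\to[0,\infty)$ is piecewise continuously differentiable in $t$ and continuously differentiable in $x$. For every $t\in[\tau,t_{\mathrm f}]$ and every $x$ with $V^\star(t,x)=1$, $$\frac{\partial V^\star}{\partial x}(t,x)\,f(t,x)+\frac{\partial V^\star}{\partial t}(t,x)<0.$$ Moreover $\{x : V^\star(t_{\mathrm f},x)\le 1\}\subset\mathcal{G}$. (2) Consequently, the set $\mathcal{F}=\{(t,x)\in[\tau,t_{\mathrm f}]\times\mathbb{R}^n : V^\star(t,x)\le 1\}$ is a funnel into $\mathcal{G}$.
   Context: $\mathbb{S}^n_+$ denotes the set of symmetric positive definite $n\times n$ real matrices, and a prime denotes transpose. A set $\mathcal{F}\subset[t_0,t_{\mathrm f}]\times\mathbb{R}^n$ is a funnel (for $\dot x(t)=f(t,x(t))$) if for each $(s,x_s)\in\mathcal{F}$ the solution with $x(s)=x_s$ exists on $[s,t_{\mathrm f}]$ and $(t,x(t))\in\mathcal{F}$ for every $t\in[s,t_{\mathrm f}]$. It is a funnel into $\mathcal{G}$ if it is a funnel and, in addition, $(t_{\mathrm f},x)\in\mathcal{F}$ implies $x\in\mathcal{G}$. Convention on piecewise data: ''piecewise'' refers to finitely many break points in time. Solutions of the differential equations are continuous and piecewise continuously differentiable in $t$. At break points, conditions involving $\frac{\partial}{\partial t}V^\star$ are required for both the left and the right derivative, with $f$ (and $A$, $Q$) taken as the corresponding one-sided limits. *)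

(* Defs.v *)
(* R^n is 'cV[R]_n. Functions of time are total functions on R of which only the
   values on the time interval at hand are constrained or used. *)
From mathcomp Require Import all_boot all_order all_algebra.
From mathcomp Require Import all_classical all_reals all_analysis.
(* Required without Import: its notations clash with those of the analysis library. *)
From mathcomp Require mpoly.

Set Implicit Arguments.
Unset Strict Implicit.
Unset Printing Implicit Defensive.

Import Order.TTheory GRing.Theory Num.Theory.
Import numFieldNormedType.Exports.

Local Open Scope classical_set_scope.
Local Open Scope ring_scope.

(* x' P x *)
Definition qform (R : realType) (n : nat) (P : 'M[R]_n) (x : 'cV[R]_n) : R :=
  (x^T *m P *m x) 0 0.

Definition symposdef (R : realType) (n : nat) (P : 'M[R]_n) : Prop :=
  P^T = P /\ forall x : 'cV[R]_n, x != 0 -> 0 < qform P x.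

Definition ellipsoid (R : realType) (n : nat) (P : 'M[R]_n) (c : 'cV[R]_n) :
    set 'cV[R]_n :=
  [set x | qform P (x - c) <= 1].

Definition box (R : realType) (n : nat) (ab : 'cV[R]_n * 'cV[R]_n) :
    set 'cV[R]_n :=
  [set x | forall i, ab.1 i 0 <= x i 0 <= ab.2 i 0].

(* n-dimensional Lebesgue (outer) measure: infimum of the total volume over the
   countable covers by nonempty closed boxes. *)
Definition volume (R : realType) (n : nat) (S : set 'cV[R]_n) : \bar R :=
  ereal_inf [set (\sum_(0 <= k <oo)
                    (\prod_(i < n) ((ab k).2 i 0 - (ab k).1 i 0))%:E)%E
            | ab in [set ab : nat -> 'cV[R]_n * 'cV[R]_n |
                (forall k i, (ab k).1 i 0 <= (ab k).2 i 0) /\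
                S `<=` \bigcup_k box (ab k)]].

Definition largest_centered_ellipsoid (R : realType) (n : nat)
    (G : set 'cV[R]_n) (c : 'cV[R]_n) (P : 'M[R]_n) : Prop :=
  [/\ symposdef P, ellipsoid P c `<=` G &
      forall P' : 'M[R]_n, symposdef P' -> ellipsoid P' c `<=` G ->
        (volume (ellipsoid P' c) <= volume (ellipsoid P c))%E].

(* [K c d] holds for each piece [c, d] of some partition
   a = s_0 < s_1 < ... < s_N = b. *)
Definition piecewise (R : realType) (a b : R) (K : R -> R -> Prop) : Prop :=
  exists2 s : seq R, itv_partition a b s &
    forall k, (k < size s)%N -> K (nth b (a :: s) k) (nth b s k).

(* The values of f at the break points of the pieces are not tied to the
   polynomials of the adjacent pieces. *)
Definition piecewise_polynomial (R : realType) (n : nat) (a b : R)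
    (f : R -> 'cV[R]_n -> 'cV[R]_n) : Prop :=
  (forall t, t \in `[a, b] -> exists q : 'I_n -> mpoly.mpoly n R,
     forall x i, f t x i 0 = mpoly.meval (fun j => x j 0) (q i)) /\
  piecewise a b (fun c d => exists p : 'I_n -> mpoly.mpoly n {poly R},
    forall t, t \in `]c, d[ -> forall x i,
      f t x i 0 = (mpoly.meval (fun j => (x j 0)%:P) (p i)).[t]).

(* Continuously differentiable on ]c, d[, with a derivative extending
   continuously to [c, d]; for g continuous on [c, d] this gives the one-sided
   derivatives at c and d. *)
Definition C1_piece (R : realType) (W : normedModType R) (g : R -> W)
    (c d : R) : Prop :=
  exists2 dg : R -> W, {within `[c, d], continuous dg} &
    forall t, t \in `]c, d[ -> is_derive t 1 g (dg t).

Definition piecewise_C1 (R : realType) (W : normedModType R) (a b : R)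
    (g : R -> W) : Prop :=
  {within `[a, b], continuous g} /\ piecewise a b (C1_piece g).

(* y' = F t y on [a, b], the equation being required off finitely many points:
   for F with one-sided limits in t, it passes to the one-sided derivatives at
   the break points. *)
Definition ode_solution (R : realType) (W : normedModType R)
    (F : R -> W -> W) (a b : R) (y : R -> W) : Prop :=
  piecewise_C1 a b y /\
  piecewise a b (fun c d =>
    forall t, t \in `]c, d[ -> is_derive t 1 y (F t (y t))).

Definition jacobian_cv (R : realType) (n : nat) (g : 'cV[R]_n -> 'cV[R]_n)
    (x : 'cV[R]_n) : 'M[R]_n :=
  \matrix_(i, j) 'D_(delta_mx j 0) (fun y => g y i 0) x.

Definition gradient (R : realType) (n : nat) (g : 'cV[R]_n -> R)
    (x : 'cV[R]_n) : 'rV[R]_n :=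
  \row_j 'D_(delta_mx j 0) g x.

Definition C1_space (R : realType) (n : nat) (g : 'cV[R]_n -> R) : Prop :=
  (forall x, differentiable g x) /\ continuous (gradient g).

(* The break points in time are common to all x. *)
Definition piecewise_C1_time_C1_space (R : realType) (n : nat) (a b : R)
    (V : R -> 'cV[R]_n -> R) : Prop :=
  [/\ forall x, {within `[a, b], continuous (V^~ x)},
      piecewise a b (fun c d => forall x, C1_piece (V^~ x) c d) &
      forall t, t \in `[a, b] -> C1_space (V t)].

(* dV/dx f + dV/dt < 0 at (t, x) with the one-sided time derivative of V and the
   one-sided limit of f(., x) along H, which is t^'+ or t^'-. *)
Definition one_sided_decrease (R : realType) (n : nat)
    (f : R -> 'cV[R]_n -> 'cV[R]_n) (V : R -> 'cV[R]_n -> R)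
    (t : R) (x : 'cV[R]_n) (H : set_system R) : Prop :=
  exists v : 'cV[R]_n, exists dV : R,
    [/\ f^~ x @ H --> v,
        (fun s => (V s x - V t x) / (s - t)) @ H --> dV &
        (gradient (V t) x *m v) 0 0 + dV < 0].

(* Inside ]a, b[ and away from the break points, v = f(t, x) and the two
   one-sided conditions are the ordinary inequality; at a and b only the inner
   one is meaningful. *)
Definition decrease (R : realType) (n : nat) (a b : R)
    (f : R -> 'cV[R]_n -> 'cV[R]_n) (V : R -> 'cV[R]_n -> R)
    (t : R) (x : 'cV[R]_n) : Prop :=
  (t < b -> one_sided_decrease f V t x t^'+) /\
  (a < t -> one_sided_decrease f V t x t^'-).

(* "The solution through (s, xs) exists and stays in F": a solution exists and
   every solution stays in F. *)
Definition funnel (R : realType) (n : nat) (t0 tf : R)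
    (f : R -> 'cV[R]_n -> 'cV[R]_n) (F : set (R * 'cV[R]_n)) : Prop :=
  (forall t x, F (t, x) -> t \in `[t0, tf]) /\
  forall s xs, F (s, xs) ->
    (exists2 y, ode_solution f s tf y & y s = xs) /\
    (forall y, ode_solution f s tf y -> y s = xs ->
       forall t, t \in `[s, tf] -> F (t, y t)).

Definition funnel_into (R : realType) (n : nat) (t0 tf : R)
    (f : R -> 'cV[R]_n -> 'cV[R]_n) (G : set 'cV[R]_n)
    (F : set (R * 'cV[R]_n)) : Prop :=
  funnel t0 tf f F /\ forall x, F (tf, x) -> G x.

(* Main.v *)
(* Solving y' = A y forward from (t, z) makes y' P0 y nonincreasing, while |y| decays
   at most exponentially, so P0(t) >= m I on [tau, tf] with m > 0 independent of t;
   this needs Q(t) only nonnegative, so that degenerate one-sided limits of Q are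
   harmless. Along a solution, with z = x - x0 and the first-order part of f cancelled
   by the Lyapunov equation,
     dV/dt <= - c / (tf - tau) V + C e^(c (tf - t) / (tf - tau)) |z|^3.
   Where 1/2 <= V <= 2 one has |z|^2 <= rho^2 e^(- c (tf - t) / (tf - tau)) with
   rho^2 = 2 / m, so the cubic term is at most C rho^3 whatever c is, and a large c
   gives dV/dt <= -1 on the whole band. One-sided limits of this inequality give the
   decrease condition at every time, and the band makes V <= 1 invariant. A solution
   starting in V <= 1 exists because the field truncated outside a ball is globally
   Lipschitz (Picard iteration piece by piece) and its solution, confined to V <= 1,
   never sees the truncation. *)
Require Import Defs.
From mathcomp Require Import all_boot all_order all_algebra.
From mathcomp Require Import all_classical all_reals all_analysis.
From mathcomp Require Import ring lra.
From mathcomp Require mpoly.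

Set Implicit Arguments.
Unset Strict Implicit.
Unset Printing Implicit Defensive.

Import Order.TTheory GRing.Theory Num.Theory.
Import numFieldNormedType.Exports.

Local Open Scope classical_set_scope.
Local Open Scope ring_scope.

(** The value of [f] at a break point is not tied to the neighbouring pieces, and [f], [x0], [P0]
    and a competing solution each have their own break points. Differential arguments therefore run
    off a finite list of times, monotonicity coming from continuity and the mean value theorem. On
    each open piece [f] agrees with a polynomial field defined at all times, whose values at the
    ends of the piece are the one-sided limits of [f]. The choice of c is not circular: the lower
    bound m depends on [P0] alone, so the radius rho of the band and the Taylor constant on the ball
    of radius sup |x0| + rho are fixed before c; since the exponential weight is at least 1, they
    serve for every c > 0. The norm of a matrix is its largest absolute entry, whence the factors n
    in the constants. Because this norm is not differentiable, the decay of solutions of y' = A y is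
    measured by the squared Euclidean norm [qform 1%:M]. *)

(** * Entrywise limits, derivatives and norms of matrices *)

Section MatrixAnalysis.
Context {R : realType}.

Lemma normr_mxE m n (M : 'M[R]_(m, n)) i j : `|M i j| <= `|M|.
Proof.
rewrite [leRHS]/Num.Def.normr/= mx_normrE.
exact: (le_bigmax _ (fun ij => `|M ij.1 ij.2|) (i, j)).
Qed.

Lemma mx_norm_le m n (M : 'M[R]_(m, n)) e : 0 <= e ->
  (forall i j, `|M i j| <= e) -> `|M| <= e.
Proof.
by move=> e0 h; rewrite /Num.Def.normr/= mx_normrE bigmax_le// => -[i j] _ /=.
Qed.

Lemma cvg_mxP T (F : set_system T) {FF : Filter F} m n
    (f : T -> 'M[R]_(m, n)) (M : 'M[R]_(m, n)) :
  f @ F --> M <-> forall i j, (fun t => f t i j) @ F --> M i j.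
Proof.
split=> [fM i j|h].
  apply/cvgrPdist_le => e e0; move/cvgrPdist_le : fM => /(_ _ e0).
  apply: filterS => t; apply: le_trans.
  by have := normr_mxE (M - f t) i j; rewrite !mxE.
apply/cvgrPdist_le => e e0; near=> t; apply: (mx_norm_le (ltW e0)) => i j.
rewrite !mxE; move: i j; near: t.
apply: filter_forall => i; apply: filter_forall => j.
exact: (cvgrPdist_le _ _).1.
Unshelve. all: by end_near. Qed.

Lemma cvg_mulmx T (F : set_system T) {FF : Filter F} m n p
    (f : T -> 'M[R]_(m, n)) (g : T -> 'M[R]_(n, p)) (M : 'M[R]_(m, n))
    (N : 'M[R]_(n, p)) :
  f @ F --> M -> g @ F --> N -> (fun t => f t *m g t) @ F --> M *m N.
Proof.
move=> /cvg_mxP fM /cvg_mxP gN; apply/cvg_mxP => i j; rewrite mxE.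
under eq_fun do rewrite mxE.
apply: cvg_big => [|k _]; first exact: add_continuous.
exact: cvgM.
Qed.

Lemma cvg_trmx T (F : set_system T) {FF : Filter F} m n
    (f : T -> 'M[R]_(m, n)) (M : 'M[R]_(m, n)) :
  f @ F --> M -> (fun t => (f t)^T) @ F --> M^T.
Proof.
move=> /cvg_mxP fM; apply/cvg_mxP => i j; rewrite mxE.
under eq_fun do rewrite mxE.
exact: fM.
Qed.

Lemma cvg_mx_entry T (F : set_system T) {FF : Filter F} m n
    (f : T -> 'M[R]_(m, n)) (M : 'M[R]_(m, n)) i j :
  f @ F --> M -> (fun t => f t i j) @ F --> M i j.
Proof. by move=> /cvg_mxP. Qed.

Lemma is_derive_mxP m n (f : R -> 'M[R]_(m, n)) (t : R) df :
  is_derive t 1 f df <->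
  forall i j, is_derive t (1 : R) (fun s => f s i j) (df i j).
Proof.
split=> [[h <-] i j|h].
  have := (derivable_mxP _ _ _).1 h i j => hij.
  by apply: DeriveDef => //; rewrite derive_mx// mxE.
have hf : derivable f t 1 by apply/derivable_mxP => i j; have [] := h i j.
apply: DeriveDef => //; rewrite derive_mx//; apply/matrixP => i j; rewrite mxE.
by have [_ ->] := h i j.
Qed.

Lemma is_derive_mx_entry m n (f : R -> 'M[R]_(m, n)) (t : R) df i j :
  is_derive t 1 f df -> is_derive t (1 : R) (fun s => f s i j) (df i j).
Proof. by move/is_derive_mxP. Qed.

Lemma is_derive_trmx m n (f : R -> 'M[R]_(m, n)) (t : R) df :
  is_derive t 1 f df -> is_derive t 1 (fun s => (f s)^T) df^T.
Proof.
move=> /is_derive_mxP h; apply/is_derive_mxP => i j; rewrite mxE.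
under eq_fun do rewrite mxE.
exact: h.
Qed.

Lemma is_derive_mulmx m n p (f : R -> 'M[R]_(m, n)) (g : R -> 'M[R]_(n, p))
    (t : R) df dg :
  is_derive t 1 f df -> is_derive t 1 g dg ->
  is_derive t 1 (fun s => f s *m g s) (df *m g t + f t *m dg).
Proof.
move=> /is_derive_mxP hf /is_derive_mxP hg; apply/is_derive_mxP => i j.
have -> : (fun s => (f s *m g s) i j) = \sum_(k < n) (fun s => f s i k * g s k j).
  by apply/funext => s; rewrite mxE fct_sumE.
rewrite !mxE -big_split/=.
apply: is_derive_sum => k.
have := is_deriveM (hf i k) (hg k j).
by rewrite /GRing.scale/= addrC (mulrC (g t k j)).
Qed.

Lemma norm_mulmx m n p (M : 'M[R]_(m, n)) (N : 'M[R]_(n, p)) :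
  `|M *m N| <= n%:R * `|M| * `|N|.
Proof.
apply: mx_norm_le => [|i j]; first by rewrite !mulr_ge0.
rewrite mxE; apply: le_trans (ler_norm_sum _ _ _) _.
apply: (@le_trans _ _ (\sum_(k < n) `|M| * `|N|)).
  by apply: ler_sum => k _; rewrite normrM ler_pM// normr_mxE.
by rewrite sumr_const card_ord -mulrA mulr_natl.
Qed.

Lemma norm_trmx m n (M : 'M[R]_(m, n)) : `|M^T| = `|M|.
Proof.
have le p q (N : 'M[R]_(p, q)) : `|N^T| <= `|N|.
  by apply: mx_norm_le => // i j; rewrite mxE normr_mxE.
by apply/eqP; rewrite eq_le le /= -{1}[M]trmxK le.
Qed.

Lemma mx11D (A B : 'M[R]_1) : (A + B) 0 0 = A 0 0 + B 0 0.
Proof. by rewrite mxE. Qed.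

Lemma mx11Z (a : R) (A : 'M[R]_1) : (a *: A) 0 0 = a * A 0 0.
Proof. by rewrite mxE. Qed.

End MatrixAnalysis.

(** * Partitions of a time interval *)

Section Pieces.
Context {R : realType}.

(* Compared with [piecewise], exceptional sets are combined by mere concatenation,
   without constructing a common refinement. *)
Definition off (S : seq R) (a b : R) (K : R -> R -> Prop) : Prop :=
  forall c d, a <= c -> c < d -> d <= b ->
    (forall r, r \in S -> r \notin `]c, d[) -> K c d.

Lemma off_restrict S a b a' b' (K : R -> R -> Prop) :
  a <= a' -> b' <= b -> off S a b K -> off S a' b' K.
Proof.
move=> aa' bb' h c d ac cd db h'.
by apply: h => //; [exact: le_trans ac|exact: le_trans bb'].
Qed.

(** An interval with no break point inside lies in a single piece, from which [K] descends by
    monotonicity. *)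
Lemma piecewise_off a b (K : R -> R -> Prop) :
  (forall c d c' d', c <= c' -> c' < d' -> d' <= d -> K c d -> K c' d') ->
  piecewise a b K -> exists S, off S a b K.
Proof.
move=> Kmono [s sab Ks]; exists s.
elim: s a sab Ks => [|x s IH] a sab Ks c d ac cd db Scd.
  by have := itv_partition_nil sab => ab; lra.
have [dx|xd] := leP d x; first exact: (Kmono _ _ _ _ ac cd dx (Ks 0%N _)).
have xc : x <= c.
  by have := Scd x; rewrite inE eqxx => /(_ isT); rewrite in_itv/= xd andbT -leNgt.
apply: (IH x) => //.
- exact: itv_partition_cons sab.
- by move=> k ks; apply: (Ks k.+1).
- by move=> r rs; apply: Scd; rewrite inE rs orbT.
Qed.

Lemma piecewise_cat a b c (K : R -> R -> Prop) :
  piecewise a b K -> piecewise b c K -> piecewise a c K.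
Proof.
move=> [s sab Ks] [t tbc Kt].
have ls : last a s = b by case: sab => _ /eqP.
exists (s ++ t); first exact: itv_partition_cat sab tbc.
move=> k; rewrite size_cat => kst.
have [ks|sk] := ltnP k (size s).
  rewrite -cat_cons !nth_cat ks/= (leqW ks).
  rewrite (set_nth_default b c (s := a :: s)) ?(set_nth_default b c (s := s))//.
    exact: Ks.
  by rewrite /= (leqW ks).
(* [belast a s] has the size of [s], so index [k - size s] reads the left end points of the second
   partition, headed by [b]. *)
have -> : a :: s ++ t = belast a s ++ (b :: t).
  by rewrite -cat_cons lastI ls cat_rcons.
rewrite !nth_cat size_belast ltnNge sk/=.
by apply: Kt; rewrite ltn_subLR.
Qed.

(** Induction on [S]: a point of [S] strictly inside splits the interval in two, any other point is
    dropped. *)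
Lemma off_piecewise S a b (K : R -> R -> Prop) :
  a <= b -> off S a b K -> piecewise a b K.
Proof.
rewrite le_eqVlt => /predU1P[<- _|ab]; first by exists [::].
elim: S a b ab => [|r S IH] a b ab h.
  exists [:: b]; first exact: itv_partition1.
  by case=> // _; apply: h.
have [/[!in_itv]/= /andP[ar rb]|rab] := boolP (r \in `]a, b[).
  apply: (@piecewise_cat _ r); apply: IH => // c d ac cd db Scd; apply: h => //.
  - exact: le_trans db (ltW rb).
  - move=> q; rewrite inE => /predU1P[->|/Scd//].
    by rewrite in_itv/= negb_and -!leNgt db orbT.
  - exact: le_trans (ltW ar) ac.
  - move=> q; rewrite inE => /predU1P[->|/Scd//].
    by rewrite in_itv/= negb_and -!leNgt ac.
apply: IH => // c d ac cd db Scd; apply: h => // q.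
rewrite inE => /predU1P[->|/Scd//].
apply: contra rab; rewrite !in_itv/= => /andP[cr rd].
by rewrite (le_lt_trans ac cr) (lt_le_trans rd db).
Qed.

Lemma piecewise_sub_off a b (P : R -> Prop) :
  piecewise a b (fun c d => forall t, t \in `]c, d[ -> P t) ->
  exists S : seq R, forall t, t \in `]a, b[ -> t \notin S -> P t.
Proof.
move=> [s sab Ps]; exists s.
elim: s a sab Ps => [|x s IH] a sab Ps t /[!in_itv]/= /andP[a_t tb].
  by have := itv_partition_nil sab => ab; lra.
rewrite inE negb_or => /andP[tx ts].
have [{}tx|xt|xt] := ltgtP t x; last by rewrite xt eqxx in tx.
  by apply: (Ps 0%N) => //; rewrite in_itv/= a_t tx.
apply: (IH x) => //.
- exact: itv_partition_cons sab.
- by move=> k ks; apply: (Ps k.+1).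
- by rewrite in_itv/= xt tb.
Qed.

(** The pieces are finitely many and [B] is monotone in the constant, so the maximum of the
    constants serves all of them. *)
Lemma piecewise_uniform a b (B : R -> R -> R -> Prop) :
  (forall k k' c d, k <= k' -> B k c d -> B k' c d) ->
  piecewise a b (fun c d => exists k, B k c d) ->
  exists k, piecewise a b (B k).
Proof.
move=> Bmono [s sab Bs].
suff [k hk] : exists k, forall m, (m < size s)%N ->
    B k (nth b (a :: s) m) (nth b s m) by exists k; exists s.
have : (size s <= size s)%N by [].
elim: {1 3}(size s) => [_|m IH ms]; first by exists 0.
have [k hk] := IH (ltnW ms); have [k' hk'] := Bs m ms.
exists (Num.max k k') => j; rewrite ltnS leq_eqVlt => /predU1P[->|jm].
  by apply: Bmono hk'; rewrite le_max lexx orbT.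
by apply: Bmono (hk j jm); rewrite le_max lexx.
Qed.

Definition clamp (a b t : R) : R := Num.max a (Num.min b t).

Lemma clamp_itv a b t : a <= b -> clamp a b t \in `[a, b].
Proof. by move=> ab; rewrite in_itv/= /clamp le_max lexx/= ge_max ab ge_min lexx. Qed.

Lemma clampE a b t : t \in `[a, b] -> clamp a b t = t.
Proof. by rewrite in_itv/= /clamp => /andP[a_t tb]; rewrite min_r// max_r. Qed.

Lemma continuous_clamp a b : continuous (clamp a b).
Proof.
move=> t; apply: (@continuous_max _ _ (cst a) (Num.min b)); first exact: cvg_cst.
by apply: (@continuous_min _ _ (cst b) id); [exact: cvg_cst|exact: cvg_id].
Qed.

Lemma clamp_dist a b s t : `|clamp a b s - clamp a b t| <= `|s - t|.
Proof.
rewrite ler_norml.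
have h (c u v : R) : Num.max c u - Num.max c v <= Num.max 0 (u - v).
  by rewrite le_max; case: (leP c u) => ?; case: (leP c v) => ?; lra.
have h' (c u v : R) : Num.max 0 (Num.min c u - Num.min c v) <= Num.max 0 (u - v).
  by rewrite ge_max !le_max lexx/=; case: (leP c u) => ?; case: (leP c v) => ?; lra.
have k (u v : R) : `|u - v| >= Num.max 0 (u - v) by rewrite ge_max normr_ge0 ler_norm.
have H u v : clamp a b u - clamp a b v <= `|u - v|.
  exact: le_trans (h _ _ _) (le_trans (h' _ _ _) (k _ _)).
by rewrite lerNl opprB {1}distrC !H.
Qed.

(** Extending by constants outside the segment trades continuity within a subspace for continuity on
    the whole line, with two-sided limits at the end points. *)
Lemma within_clamp (W : normedModType R) a b (g : R -> W) : a <= b ->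
  {within `[a, b], continuous g} <-> continuous (g \o clamp a b).
Proof.
move=> ab; split=> [/subspace_continuousP gc t|gc].
  apply: (@cvg_comp _ _ _ (clamp a b) g _ (within `[a, b]%classic (nbhs (clamp a b t)))).
    move=> A hA; have hA' : nbhs t (clamp a b @^-1` [set u | `[a, b]%classic u -> A u]).
      exact: continuous_clamp hA.
    change (nbhs t (clamp a b @^-1` A)); apply: filterS hA' => u; apply.
    exact: (clamp_itv u ab).
  exact/gc/clamp_itv.
have : {within `[a, b], continuous (g \o clamp a b)}.
  exact: continuous_subspaceT.
apply: subspace_eq_continuous => t; rewrite inE/= => /clampE e.
by rewrite /= /from_subspace /= e.
Qed.

Lemma within_continuous_bounded (W : normedModType R) a b (g : R -> W) :
  {within `[a, b], continuous g} ->
  exists2 M, 0 < M & forall t, t \in `[a, b] -> `|g t| <= M.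
Proof.
move=> gc.
have : compact (g @` `[a, b]%classic).
  by apply: continuous_compact => //; exact: segment_compact.
move=> /compact_bounded [M [_ hM]]; exists (`|M| + 1); first by rewrite ltr_wpDl.
move=> t tab; apply: hM; last by exists t.
by rewrite (le_lt_trans (ler_norm M))// ltrDl.
Qed.

End Pieces.

(** * One-variable calculus off finitely many times *)

Section RealCalculus.
Context {R : realType}.

Lemma near_right_itv (x : R) (P : R -> Prop) :
  (\forall t \near x^'+, P t) -> exists2 d, x < d & forall t, x < t < d -> P t.
Proof.
move=> [e /= e0 h]; exists (x + e); first by rewrite ltrDl.
move=> t /andP[xt te]; apply: h => //=.
by rewrite ltr_distlC; apply/andP; split; lra.
Qed.

Lemma near_left_itv (x : R) (P : R -> Prop) :
  (\forall t \near x^'-, P t) -> exists2 d, d < x & forall t, d < t < x -> P t.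
Proof.
move=> [e /= e0 h]; exists (x - e); first by rewrite ltrBlDr ltrDl.
move=> t /andP[xt te]; apply: h => //=.
by rewrite ltr_distlC; apply/andP; split; lra.
Qed.

Lemma near_right_notin (x : R) (S : seq R) : \forall t \near x^'+, t \notin S.
Proof.
elim: S => [|r S IH]; first by near=> t.
have xr : \forall t \near x^'+, t != r.
  have [rx|xr] := leP r x; near=> t.
    by rewrite gt_eqF// (le_lt_trans rx)//; near: t; exact: nbhs_right_gt.
  by rewrite lt_eqF//; near: t; exact: nbhs_right_lt.
by near=> t; rewrite inE negb_or; apply/andP; split; near: t.
Unshelve. all: by end_near. Qed.

Lemma near_left_notin (x : R) (S : seq R) : \forall t \near x^'-, t \notin S.
Proof.
elim: S => [|r S IH]; first by near=> t.
have xr : \forall t \near x^'-, t != r.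
  have [xr|rx] := leP x r; near=> t.
    by rewrite lt_eqF// (lt_le_trans _ xr)//; near: t; exact: nbhs_left_lt.
  by rewrite gt_eqF//; near: t; exact: nbhs_left_gt.
by near=> t; rewrite inE negb_or; apply/andP; split; near: t.
Unshelve. all: by end_near. Qed.

Lemma within_sub (W : normedModType R) (a b c d : R) (g : R -> W) :
  a <= c -> d <= b ->
  {within `[a, b], continuous g} -> {within `[c, d], continuous g}.
Proof.
move=> ac db; apply: continuous_subspaceW => t /=; rewrite !in_itv/= => /andP[ct td].
by rewrite (le_trans ac ct) (le_trans td db).
Qed.

(** If g(t1) > l, let [ts] be the last time before t1 with g <= l. Just after [ts], g lies in the
    band ]l, u[ and no time of [S] occurs, so the mean value theorem keeps g below g(ts) <= l, a
    contradiction. The sign of the derivative is asked only in the band because the decay of V is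
    known only there. *)
Lemma barrier (S : seq R) (a b l u : R) (g : R -> R) : l < u ->
  {within `[a, b], continuous g} -> g a <= l ->
  (forall t, t \in `]a, b[ -> t \notin S -> l < g t < u ->
     exists2 dg, is_derive t 1 g dg & dg <= 0) ->
  forall t, t \in `[a, b] -> g t <= l.
Proof.
move=> lu gc gal gd t1 /[!in_itv]/= /andP[at1 t1b].
have ab := le_trans at1 t1b.
rewrite leNgt; apply/negP => lg1.
(* [G] gives neighbourhoods of [ts] even when [ts] is an end point of the segment. *)
have Gc := (within_clamp _ ab).1 gc; set G := g \o _ in Gc.
have GE t : a <= t <= b -> G t = g t by move=> tab; rewrite /G/= clampE.
pose E := [set s | a <= s <= t1 /\ g s <= l].
have Ea : E a by split=> //; rewrite lexx.
have Eub : ubound E t1 by move=> s [/andP[]].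
have Es : has_sup E by split; [exists a|exists t1].
set ts := sup E.
have ats : a <= ts by apply: ub_le_sup => //; exists t1.
have tst1 : ts <= t1 by apply: ge_sup => //; exists a.
have gts : g ts <= l.
  rewrite leNgt; apply/negP => lgts.
  have : \forall t \near ts, l < G t.
    by apply: (cvgr_gt (f := G) _ (Gc ts)); rewrite GE// ats (le_trans tst1).
  move=> [e /= e0 he].
  have [s [/andP[as_ st1] gsl]] := sup_adherent e0 Es; rewrite -/ts => ss.
  have sts : s <= ts by apply: ub_le_sup; [exists t1|split=> //; apply/andP].
  have := he s; rewrite GE ?as_ ?(le_trans st1)// ltNge gsl => /(_ _)/negP; apply => //=.
  by rewrite ltr_distlC; apply/andP; split; lra.
have {}tst1 : ts < t1.
  by rewrite lt_neqAle tst1 andbT; apply/eqP => tsE; move: lg1; rewrite -tsE ltNge gts.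
have gt_l t : ts < t <= t1 -> l < g t.
  move=> /andP[tst tt1]; rewrite ltNge; apply/negP => gtl.
  suff : t <= ts by rewrite leNgt tst.
  by apply: ub_le_sup; [exists t1|split=> //; rewrite tt1 (le_trans ats)// ltW].
have : \forall t \near ts^'+, [/\ t < t1, t \notin S & G t < u].
  near=> t; split; near: t.
  - exact: nbhs_right_lt.
  - exact: near_right_notin.
  - apply: (cvgr_lt (f := G) _ (cvg_at_right_filter (Gc ts))).
    by rewrite GE ?(le_lt_trans gts)// ats (le_trans (ltW tst1)).
move=> /near_right_itv[d tsd hd].
(* Any time strictly between [ts] and both [d] and [t1] would do: up to it, g stays in the band and
   [S] is avoided. *)
pose t2 := (ts + Num.min d t1) / 2.
have [t2d t2t1 tst2] : [/\ t2 < d, t2 < t1 & ts < t2].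
  by rewrite /t2; case: (leP d t1) => ?; split; lra.
have dg t : t \in `]ts, t2[ -> is_derive t 1 g ('D_1 g t) /\ 'D_1 g t <= 0.
  rewrite in_itv/= => /andP[tst tt2].
  have [] := hd t; first by rewrite tst (lt_trans tt2).
  move=> tt1 tS Gtu; have [||dg gdg dg0] := gd t _ tS.
  - by rewrite in_itv/= (le_lt_trans ats tst) (lt_le_trans tt1).
  - by rewrite gt_l ?tst ?ltW//= -GE// ?(le_trans ats (ltW tst))//= (le_trans (ltW tt1)).
  - by have [h e] := gdg; rewrite e; split=> //; exact: DeriveDef.
have [||c cts] := @MVT _ g ('D_1 g) ts t2 tst2.
- by move=> t /dg[].
- by apply: within_sub gc => //; lra.
- move=> e; have [_ d0] := dg c cts.
  have := gt_l t2; rewrite tst2 ltW// => /(_ isT).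
  have : 'D_1 g c * (t2 - ts) <= 0 by rewrite mulr_le0_ge0// subr_ge0 ltW.
  lra.
Unshelve. all: by end_near. Qed.

Lemma is_derive_expRM (k c t : R) :
  is_derive t (1 : R) (fun s => expR (k * (s - c))) (k * expR (k * (t - c))).
Proof.
have h1 : is_derive t (1 : R) (fun s : R => s - c) (1 - 0) by apply: is_deriveB.
have h2 := is_deriveZ k h1; rewrite subr0 /GRing.scale/= mulr1 in h2.
by rewrite mulrC; exact: @is_derive1_comp _ expR _ _ _ _ (is_derive_expR _) h2.
Qed.

(** The barrier placed at height g(a), with a band of arbitrary width 1. *)
Lemma nonincreasing_off (S : seq R) (a b : R) (g : R -> R) : a <= b ->
  {within `[a, b], continuous g} ->
  (forall t, t \in `]a, b[ -> t \notin S ->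
     exists2 dg, is_derive t 1 g dg & dg <= 0) ->
  g b <= g a.
Proof.
move=> ab gc gd; apply: (@barrier S a b (g a) (g a + 1) g) => //.
- by rewrite ltrDl.
- by move=> t tab tS _; exact: gd.
- by rewrite in_itv/= ab lexx.
Qed.

(** The mean value theorem turns the difference quotient into a value of [dg] at an intermediate
    time, which is squeezed to c. This yields one-sided derivatives at break points. *)
Lemma right_diff_quotient (c d l : R) (g dg : R -> R) : c < d ->
  {within `[c, d], continuous g} ->
  (forall t, t \in `]c, d[ -> is_derive t 1 g (dg t)) ->
  dg @ c^'+ --> l ->
  (fun s => (g s - g c) / (s - c)) @ c^'+ --> l.
Proof.
move=> cd gc gd dgl; apply/cvgrPdist_le => e e0.
move/cvgrPdist_le : dgl => /(_ _ e0) /near_right_itv[d' cd' hd'].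
near=> s.
have cs : c < s by near: s; exact: nbhs_right_gt.
have sd : s < d by near: s; exact: nbhs_right_lt.
have sd' : s < d' by near: s; exact: nbhs_right_lt.
have [||x] := @MVT _ g dg c s cs.
- by move=> t /[!in_itv]/= /andP[ct ts]; apply: gd; rewrite in_itv/= ct (lt_trans ts).
- by apply: within_sub gc => //; exact: ltW.
rewrite in_itv/= => /andP[cx xs] ->.
by rewrite mulfK ?subr_eq0 ?gt_eqF// hd'// cx (lt_trans xs).
Unshelve. all: by end_near. Qed.

Lemma left_diff_quotient (c d l : R) (g dg : R -> R) : d < c ->
  {within `[d, c], continuous g} ->
  (forall t, t \in `]d, c[ -> is_derive t 1 g (dg t)) ->
  dg @ c^'- --> l ->
  (fun s => (g s - g c) / (s - c)) @ c^'- --> l.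
Proof.
move=> dc gc gd dgl; apply/cvgrPdist_le => e e0.
move/cvgrPdist_le : dgl => /(_ _ e0) /near_left_itv[d' d'c hd'].
near=> s.
have sc : s < c by near: s; exact: nbhs_left_lt.
have ds : d < s by near: s; exact: nbhs_left_gt.
have d's : d' < s by near: s; exact: nbhs_left_gt.
have h1 t : t \in `]s, c[ -> is_derive t 1 g (dg t).
  move=> /[!in_itv]/= /andP[st tc]; apply: gd.
  by rewrite in_itv/= tc (lt_trans ds).
have h2 : {within `[s, c], continuous g}.
  by apply: within_sub gc; [exact: ltW|].
have [x] := MVT sc h1 h2.
rewrite in_itv/= => /andP[sx xc] e1.
have -> : (g s - g c) / (s - c) = dg x.
  have cs0 : c - s != 0 by rewrite subr_eq0 gt_eqF.
  by rewrite -(opprB (g c)) e1 -(opprB c s) invrN mulrNN mulfK.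
by rewrite hd'// xc (lt_trans d's).
Unshelve. all: by end_near. Qed.

End RealCalculus.

(** * Existence of solutions *)

Section Picard.
Context {R : realType}.

Lemma continuous_primitive (g : R -> R) (c : R) : continuous g ->
  exists G : R -> R, [/\ continuous G, forall t, t <= c -> G t = 0 &
    forall t, c < t -> is_derive t 1 G (g t)].
Proof.
(* Starting the integral at [c - 1] makes [c] an interior point, so that F is derivable, hence
   continuous, at [c] too. *)
move=> gc; pose F x := (\int[lebesgue_measure]_(t in `[c - 1, x]) g t)%R.
have Fd x : c - 1 < x -> derivable F x 1 /\ F^`()%classic x = g x.
  move=> cx; apply: (@continuous_FTC1_closed R g (c - 1) x (x + 1)) => //.
  - by rewrite ltrDl.
  - apply: continuous_compact_integrable; first exact: segment_compact.
    exact: continuous_subspaceT.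
  - exact: gc.
exists (fun t => F (Num.max t c) - F c); split=> [t|t tc|t ct].
- apply: cvgB; last exact: cvg_cst.
  apply: (@continuous_comp _ _ _ (fun t => Num.max t c) F).
    by apply: continuous_max; [exact: cvg_id|exact: cvg_cst].
  apply/differentiable_continuous/derivable1_diffP.
  by have [] := Fd (Num.max t c); rewrite // lt_max; apply/orP; right; lra.
- by rewrite max_r// subrr.
- have [dF eF] := Fd t ltac:(lra).
  apply: (@near_eq_is_derive _ _ _ (fun t => F t - F c)).
    near=> s; rewrite max_l//; apply: ltW.
    by near: s; exact: lt_nbhsr.
  rewrite -[g t]subr0; apply: is_deriveB.
  by rewrite -eF derive1E; exact/derivableP.
Unshelve. all: by end_near. Qed.

(** Both u - v and - u - v are nonincreasing. *)
Lemma derive_comparison (c : R) (u v du dv : R -> R) :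
  continuous u -> continuous v ->
  (forall t, c < t -> is_derive t 1 u (du t)) ->
  (forall t, c < t -> is_derive t 1 v (dv t)) ->
  (forall t, c < t -> `|du t| <= dv t) ->
  `|u c| <= v c -> forall t, c <= t -> `|u t| <= v t.
Proof.
move=> uc vc ud vd duv uvc t ct.
have /ler_normlP[uvc1 uvc2] := uvc.
apply/ler_normlP; split.
- have : - u t - v t <= - u c - v c; last lra.
  apply: (@nonincreasing_off _ [::] c t (fun s => - u s - v s)) => //.
    apply: continuous_subspaceT => s; apply: cvgB; last exact: vc.
    by apply: cvgN; exact: uc.
  move=> s /[!in_itv]/= /andP[cs _] _.
  exists (- du s - dv s).
    by apply: is_deriveB; [apply: is_deriveN; exact: ud|exact: vd].
  by have /ler_normlP[] := duv s cs; lra.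
- have : u t - v t <= u c - v c; last lra.
  apply: (@nonincreasing_off _ [::] c t (fun s => u s - v s)) => //.
    by apply: continuous_subspaceT => s; apply: cvgB; [exact: uc|exact: vc].
  move=> s /[!in_itv]/= /andP[cs _] _.
  exists (du s - dv s).
    by apply: is_deriveB; [exact: ud|exact: vd].
  by have /ler_normlP[] := duv s cs; lra.
Qed.

Lemma mx_derive_comparison m n (c : R) (u du : R -> 'M[R]_(m, n)) (v dv : R -> R) :
  continuous u -> continuous v -> (forall t, 0 <= v t) ->
  (forall t, c < t -> is_derive t 1 u (du t)) ->
  (forall t, c < t -> is_derive t 1 v (dv t)) ->
  (forall t, c < t -> `|du t| <= dv t) ->
  u c = 0 -> forall t, c <= t -> `|u t| <= v t.
Proof.
move=> uc vc v0 ud vd duv u0 t ct; apply: mx_norm_le => // i j.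
apply: (@derive_comparison c (fun s => u s i j) v (fun s => du s i j) dv) => //.
- by move=> s; apply: cvg_mx_entry; exact: uc.
- by move=> s /ud; exact: is_derive_mx_entry.
- by move=> s /duv; apply: le_trans; exact: normr_mxE.
- by rewrite u0 mxE normr0.
Qed.

Lemma half_exp_small (M e : R) : 0 < e -> exists k, M * 2^-1 ^+ k <= e.
Proof.
move=> e0; have q1 : `|2^-1 : R| < 1 by rewrite ger0_norm//; lra.
have : (fun k => M * 2^-1 ^+ k) @ \oo --> (0 : R).
  by rewrite -(mulr0 M); apply: cvgM; [exact: cvg_cst|exact: (cvg_expr q1)].
move/cvgrPdist_le => /(_ _ e0) [k _ /(_ k (leqnn k))/=].
by rewrite sub0r normrN => /(le_trans (ler_norm _)) ?; exists k.
Qed.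

Lemma le0_half_exp (M x : R) : (forall k, x <= M * 2^-1 ^+ k) -> x <= 0.
Proof.
move=> h; rewrite leNgt; apply/negP => x0.
have [k hk] := @half_exp_small M (x / 2) ltac:(lra).
by have := h k; lra.
Qed.

(** With e k = 2 M / 2^k the intervals [u k - e k, u k + e k] are nested, and the supremum of their
    left ends lies in all of them. This gives the limit together with its error bound. *)
Lemma geometric_limit (u : nat -> R) (M : R) :
  (forall k, `|u k.+1 - u k| <= M * 2^-1 ^+ k) ->
  exists l, forall k, `|l - u k| <= 2 * M * 2^-1 ^+ k.
Proof.
move=> h; pose e k := 2 * M * 2^-1 ^+ k : R.
have eS k : e k.+1 = e k - M * 2^-1 ^+ k by rewrite /e exprS; field.
have e0 k : 0 <= e k.
  by have := le_trans (normr_ge0 _) (h k); rewrite /e -mulrA; lra.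
have lo k m : (k <= m)%N -> u k - e k <= u m - e m.
  elim: m => [|m IH]; first by rewrite leqn0 => /eqP->.
  rewrite leq_eqVlt => /predU1P[->//|/IH]; have /ler_normlP[] := h m.
  by rewrite eS; lra.
have hi k m : (k <= m)%N -> u m + e m <= u k + e k.
  elim: m => [|m IH]; first by rewrite leqn0 => /eqP->.
  rewrite leq_eqVlt => /predU1P[->//|/IH]; have /ler_normlP[] := h m.
  by rewrite eS; lra.
have ub k : ubound (range (fun j => u j - e j)) (u k + e k).
  move=> _ [j _ <-]; have := lo j (maxn j k) (leq_maxl _ _).
  by have := hi k (maxn j k) (leq_maxr _ _); have := e0 (maxn j k); lra.
exists (sup (range (fun j => u j - e j))) => k; rewrite -/(e k).
have : sup (range (fun j => u j - e j)) <= u k + e k.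
  by apply: ge_sup (ub k); exists (u 0%N - e 0%N); exists 0%N.
have : u k - e k <= sup (range (fun j => u j - e j)).
  by apply: ub_le_sup; [exists (u k + e k)|exists k].
by move=> ? ?; rewrite ler_norml; apply/andP; split; lra.
Qed.

(* Continuity is asked only along continuous curves: this is all that makes the
   Picard iterates well defined. *)
Definition regular_field n (H : R -> 'cV[R]_n -> 'cV[R]_n) : Prop :=
  [/\ forall u, continuous u -> continuous (fun t => H t (u t)),
      exists K, forall t x y, `|H t x - H t y| <= K * `|x - y| &
      forall x, exists B, forall t, `|H t x| <= B].

(** Distances are measured against the weight exp(2 L (t - c)), for which the Picard operator
    contracts by 1/2 on the whole half-line; the interval need not be cut into short steps. *)
Lemma picard n (H : R -> 'cV[R]_n -> 'cV[R]_n) (c : R) (xs : 'cV[R]_n) :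
  regular_field H ->
  exists y, [/\ continuous y, y c = xs &
    forall t, c < t -> is_derive t 1 y (H t (y t))].
Proof.
move=> [Hc [K HK] /(_ xs)[B HB]].
pose L : R := `|K| + 1; have L0 : 0 < L by rewrite ltr_wpDl.
have HL t x y : `|H t x - H t y| <= L * `|x - y|.
  apply: le_trans (HK t x y) _; rewrite ler_wpM2r//.
  by rewrite (le_trans (ler_norm K))// lerDl.
clearbody L.
have B0 : 0 <= B by exact: le_trans (normr_ge0 _) (HB c).
(* A discontinuous [u] receives a dummy image, so that [choice] yields an operator on all functions,
   which can be iterated. *)
have stepP (u : R -> 'cV[R]_n) : exists v : R -> 'cV[R]_n, continuous u ->
    [/\ continuous v, forall t, t <= c -> v t = xs &
     forall t, c < t -> is_derive t 1 v (H t (u t))].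
  have [uc|uc] := pselect (continuous u); last by exists u => /uc.
  have uic i : continuous (fun t => H t (u t) i 0).
    by move=> t; apply: cvg_mx_entry; exact: Hc.
  have prim i := continuous_primitive c (uic i).
  have [G hG] := choice prim.
  exists (fun t => xs + \col_i G i t) => _; split.
  - move=> t; apply: cvgD; first exact: cvg_cst.
    apply/cvg_mxP => i j; rewrite mxE; under eq_fun do rewrite mxE.
    by have [Gc _ _] := hG i; exact: Gc.
  - move=> t tc; rewrite -[RHS]addr0; congr (_ + _).
    by apply/matrixP => i j; rewrite !mxE; have [_ -> ] := hG i.
  - move=> t ct; rewrite -[H _ _]add0r; apply: is_deriveD.
    apply/is_derive_mxP => i j; under eq_fun do rewrite mxE.
    by rewrite ord1; have [_ _] := hG i; apply.
have [step hstep] := choice stepP.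
pose Y k := iter k step (cst xs).
have Yc k : continuous (Y k).
  elim: k => [|k IH] ; first by move=> t; exact: cvg_cst.
  by have [] := hstep _ IH.
have YS k : [/\ continuous (Y k.+1), forall t, t <= c -> Y k.+1 t = xs &
     forall t, c < t -> is_derive t 1 (Y k.+1) (H t (Y k t))].
  exact: hstep.
have Yl k t : t <= c -> Y k t = xs by case: k => [//|k]; have [_ h _] := YS k; exact: h.
pose E t := expR (2 * L * (t - c)).
have Ed a t : is_derive t (1 : R) (fun s => a * E s) (a * (2 * L * E t)).
  exact: is_deriveZ (is_derive_expRM (2 * L) c t).
have Ec a : continuous (fun s => a * E s).
  move=> t; apply/differentiable_continuous/derivable1_diffP.
  by have [] := Ed a t.
have E1 t : c <= t -> 1 <= E t.
  move=> ct; rewrite /E -expR0 ler_expR.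
  by apply: mulr_ge0; [rewrite mulr_ge0// ltW|rewrite subr_ge0].
(* [D * E] has derivative B E >= B after [c], which dominates the derivative of the first
   iterate. *)
pose D : R := B / (2 * L).
have D0 : 0 <= D by rewrite divr_ge0// mulr_ge0// ltW.
have DE a t : 0 <= a -> 0 <= a * E t by move=> a0; rewrite mulr_ge0// expR_ge0.
have q0 k : 0 <= D * 2^-1 ^+ k by rewrite mulr_ge0// exprn_ge0.
have est k t : c <= t -> `|Y k.+1 t - Y k t| <= D * 2^-1 ^+ k * E t.
  elim: k t => [|k IH] t ct.
    apply: (@mx_derive_comparison _ _ c (fun s => Y 1%N s - Y 0%N s)
      (fun s => H s (Y 0%N s)) (fun s => _ * E s)
      (fun s => D * 2^-1 ^+ 0 * (2 * L * E s)) _ (Ec _)) => //.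
    - by move=> s; apply: cvgB; exact: Yc.
    - by move=> s; apply: DE.
    - move=> s cs; rewrite -[H _ _]subr0; apply: is_deriveB.
      by have [_ _] := YS 0%N; apply.
    - move=> s cs; apply: le_trans (HB s) _.
      rewrite expr0 mulr1 mulrA divfK ?gt_eqF ?mulr_gt0//.
      by rewrite ler_peMr// E1// ltW.
    - by rewrite !Yl// subrr.
  apply: (@mx_derive_comparison _ _ c (fun s => Y k.+2 s - Y k.+1 s)
    (fun s => H s (Y k.+1 s) - H s (Y k s)) (fun s => _ * E s)
    (fun s => D * 2^-1 ^+ k.+1 * (2 * L * E s)) _ (Ec _)) => //.
  - by move=> s; apply: cvgB; exact: Yc.
  - by move=> s; apply: DE.
  - move=> s cs; apply: is_deriveB.
      by have [_ _] := YS k.+1; apply.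
    by have [_ _] := YS k; apply.
  - move=> s cs; apply: le_trans (HL _ _ _) _.
    have -> : D * 2^-1 ^+ k.+1 * (2 * L * E s) = L * (D * 2^-1 ^+ k * E s).
      by rewrite exprS; field.
    by rewrite ler_pM2l// IH// ltW.
  - by rewrite !Yl// subrr.
have limP t : exists l : 'cV[R]_n, forall k,
    `|l - Y k t| <= 2 * D * E (Num.max t c) * 2^-1 ^+ k.
  have lP (i : 'I_n) : exists l : R, forall k,
      `|l - Y k t i 0| <= 2 * (D * E (Num.max t c)) * 2^-1 ^+ k.
    apply: geometric_limit => k.
    apply: (@le_trans _ _ `|Y k.+1 t - Y k t|).
      by have := normr_mxE (Y k.+1 t - Y k t) i 0; rewrite !mxE.
    have [tc|ct] := leP t c.
      by rewrite !Yl// subrr normr0 mulr_ge0// ?exprn_ge0// DE.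
    by rewrite mulrAC est// ltW.
  have [l hl] := choice lP.
  exists (\col_i l i) => k; apply: mx_norm_le => [|i j].
    by rewrite mulr_ge0// ?exprn_ge0// DE// mulr_ge0.
  by rewrite !mxE ord1 -(mulrA 2).
have [y hy] := choice limP.
have yc : continuous y.
  move=> t; apply/cvgrPdist_le => e e0.
  have e3 : 0 < e / 3 by lra.
  (* [M] bounds the error factor at every time near [t], so a single index [k] serves a
     neighbourhood of [t]. *)
  pose M := 2 * D * E (Num.max t c) + 1.
  have [k hk] := half_exp_small M e3.
  near=> s.
  have hs : 2 * D * E (Num.max s c) <= M.
    near: s; apply: (cvgr_le (f := fun s => 2 * D * E (Num.max s c)) (2 * D * E (Num.max t c))).
      apply: (@continuous_comp _ _ _ (fun t => Num.max t c) (fun s => 2 * D * E s)).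
        by apply: continuous_max; [exact: cvg_id|exact: cvg_cst].
      exact: Ec.
    by rewrite /M ltrDl.
  have p0 : 0 <= 2^-1 ^+ k :> R by rewrite exprn_ge0.
  have h1 : `|y t - Y k t| <= e / 3.
    by apply: le_trans (hy t k) (le_trans _ hk); rewrite ler_wpM2r// /M lerDl.
  have h2 : `|y s - Y k s| <= e / 3.
    by apply: le_trans (hy s k) (le_trans _ hk); rewrite ler_wpM2r.
  have h3 : `|Y k t - Y k s| <= e / 3.
    near: s; exact: (cvgr_dist_le _ _ (Yc k t)).
  have -> : y t - y s = (y t - Y k t) + (Y k t - Y k s) - (y s - Y k s).
    by rewrite subrKA opprB subrKA.
  apply: le_trans (ler_normB _ _) _.
  apply: le_trans (lerD (ler_normD _ _) h2) _; lra.
(* One more Picard step from the limit: [z] is differentiable by construction and is also the limit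
   of the iterates, so z = y, and no derivative is passed to the limit. *)
have [zc zl zd] := hstep y yc; set z := step y in zc zl zd.
have zest k t : `|z t - Y k.+1 t| <= D * E (Num.max t c) * 2^-1 ^+ k.
  have [tc|/ltW ct] := leP t c.
    by rewrite zl// Yl// subrr normr0 mulr_ge0// ?exprn_ge0// DE.
  rewrite mulrAC.
  apply: (@mx_derive_comparison _ _ c (fun s => z s - Y k.+1 s)
    (fun s => H s (y s) - H s (Y k s)) (fun s => _ * E s)
    (fun s => D * 2^-1 ^+ k * (2 * L * E s)) _ (Ec _)) => //.
  - by move=> s; apply: cvgB; [exact: zc|exact: Yc].
  - by move=> s; apply: DE.
  - move=> s cs; apply: is_deriveB; first exact: zd.
    by have [_ _] := YS k; apply.
  - move=> s cs; apply: le_trans (HL _ _ _) _.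
    have -> : D * 2^-1 ^+ k * (2 * L * E s) = L * (2 * D * E s * 2^-1 ^+ k) by ring.
    by rewrite ler_pM2l//; have := hy s k; rewrite max_l// ltW.
  - by rewrite zl// Yl// subrr.
have zy : z = y.
  apply/funext => t; apply/eqP; rewrite -subr_eq0 -normr_le0.
  apply: (@le0_half_exp (2 * D * E (Num.max t c))) => k.
  rewrite -(subrKA (Y k.+1 t)).
  apply: le_trans (ler_normD _ _) _.
  apply: le_trans (lerD (zest k t) _) _.
    by rewrite distrC; exact: (hy t k.+1).
  by rewrite exprS; lra.
by exists y; split=> // [|t ct]; rewrite -{1}zy; [exact: zl|exact: zd].
Unshelve. all: by end_near. Qed.

End Picard.

Section Gluing.
Context {R : realType}.

Lemma piecewise_impl (a b : R) (K K' : R -> R -> Prop) :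
  (forall c d, K c d -> K' c d) -> piecewise a b K -> piecewise a b K'.
Proof. by move=> KK' [s sab Ks]; exists s => // k /Ks/KK'. Qed.

(** The continuous derivative [dy] is kept apart from [F t (y t)], whose values at the ends of the
    piece are unconstrained. *)
Definition solution_piece n (F : R -> 'cV[R]_n -> 'cV[R]_n) (y : R -> 'cV[R]_n)
    (c d : R) : Prop :=
  exists2 dy, continuous dy &
    forall t, t \in `]c, d[ -> is_derive t 1 y (dy t) /\ dy t = F t (y t).

Lemma solution_piece_near n (F : R -> 'cV[R]_n -> 'cV[R]_n) y z (c d : R) :
  (forall t, t \in `]c, d[ -> y t = z t) ->
  solution_piece F y c d -> solution_piece F z c d.
Proof.
move=> yz [dy dyc hdy]; exists dy => // t tcd; have [h1 h2] := hdy t tcd.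
split; last by rewrite -yz.
apply: near_eq_is_derive h1.
apply: filterS (near_in_itvoo tcd) => s; exact: yz.
Qed.

Lemma ode_exists n (F : R -> 'cV[R]_n -> 'cV[R]_n) (a b : R) (xs : 'cV[R]_n) :
  piecewise a b (fun c d => exists2 G, regular_field G &
    forall t, t \in `]c, d[ -> forall x, F t x = G t x) ->
  exists y, [/\ continuous y, y a = xs & piecewise a b (solution_piece F y)].
Proof.
move=> [s]; elim: s a xs => [|x s IH] a xs sab hF.
  exists (cst xs); split=> //; first by move=> t; exact: cvg_cst.
  by exists [::].
have [/= /andP[ax _] _] := sab.
have xb := itv_partition_le (itv_partition_cons sab).
have [G Gr FG] := hF 0%N isT; rewrite /= in FG.
have [y1 [y1c y1a y1d]] := picard a xs Gr.
have [|y2 [y2c y2x y2s]] := IH x (y1 x) (itv_partition_cons sab).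
  by move=> k ks; apply: (hF k.+1).
(* Gluing at [x] by a formula that is visibly continuous: since y2 x = y1 x, the bracket vanishes
   before [x], and after [x] the terms y1 x cancel. *)
pose y t := y1 (Num.min t x) + (y2 (Num.max t x) - y1 x).
have yE1 t : t <= x -> y t = y1 t.
  by move=> tx; rewrite /y min_l// max_r// y2x subrr addr0.
have yE2 t : x <= t -> y t = y2 t.
  by move=> tx; rewrite /y min_r// max_l// addrC subrK.
exists y; split; last 1 first.
- apply: (@piecewise_cat _ _ x).
    exists [:: x]; first exact: itv_partition1.
    case=> // _ /=.
    apply: (@solution_piece_near _ _ y1) => [t|].
      by rewrite in_itv/= => /andP[_ /ltW/yE1 ->].
    exists (fun t => G t (y1 t)); first by case: Gr => + _ _; exact.
    move=> t tax; rewrite FG//; split=> //.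
    by apply: y1d; move: tax; rewrite in_itv/= => /andP[].
  (* Passing through [off] supplies [x <= c] for each piece, which identifies [y] with [y2] on
     it. *)
  have [|S hS] := piecewise_off _ y2s.
    move=> c d c' d' cc' _ d'd [dy dyc hdy]; exists dy => // t.
    rewrite in_itv/= => /andP[ct td]; apply: hdy.
    by rewrite in_itv/= (le_lt_trans cc' ct) (lt_le_trans td d'd).
  apply: (off_piecewise (S := S)) => // c d xc cd db /(hS c d xc cd db).
  apply: solution_piece_near => t; rewrite in_itv/= => /andP[ct _].
  by rewrite yE2// (le_trans xc)// ltW.
- move=> t; apply: cvgD.
    apply: (@continuous_comp _ _ _ (fun t => Num.min t x) y1); last exact: y1c.
    by apply: continuous_min; [exact: cvg_id|exact: cvg_cst].
  apply: cvgB; last exact: cvg_cst.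
  apply: (@continuous_comp _ _ _ (fun t => Num.max t x) y2); last exact: y2c.
  by apply: continuous_max; [exact: cvg_id|exact: cvg_cst].
- by rewrite yE1// ltW.
Qed.

Lemma solution_piece_ode n (F : R -> 'cV[R]_n -> 'cV[R]_n) (a b : R) y :
  continuous y -> piecewise a b (solution_piece F y) -> ode_solution F a b y.
Proof.
move=> yc ys; split.
  split; first exact: continuous_subspaceT.
  apply: piecewise_impl ys => c d [dy dyc hdy].
  exists dy; first exact: continuous_subspaceT.
  by move=> t /hdy[].
by apply: piecewise_impl ys => c d [dy dyc hdy] t /hdy[h <-].
Qed.

End Gluing.

(** * Polynomial vector fields *)

Section Tame.
Context {R : realType} (n : nat).
Implicit Types (g : R -> 'cV[R]_n -> R) (D : R -> 'cV[R]_n -> 'rV[R]_n).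

(* The uniform second-order remainder yields at once the spatial derivative D, local
   Lipschitz bounds and the quadratic error of the linearization, and it is stable
   under sums and products. *)
Definition tame g D : Prop :=
  [/\ forall (s : R -> R) (u : R -> 'cV[R]_n), continuous s -> continuous u ->
        continuous (fun t => g (s t) (u t)),
      forall (s : R -> R) (u : R -> 'cV[R]_n), continuous s -> continuous u ->
        continuous (fun t => D (s t) (u t)) &
      forall M : R, exists K : R, forall t x y, `|t| <= M -> `|x| <= M -> `|y| <= M ->
        [/\ `|g t x| <= K, `|D t x| <= K &
         `|g t y - g t x - (D t x *m (y - x)) 0 0| <= K * `|y - x| ^+ 2]].

Lemma tame_horner (p : {poly R}) : tame (fun t _ => p.[t]) (fun _ _ => 0).
Proof.
split=> [s u sc _ t|s u _ _ t|M].
- by apply: (continuous_comp (sc t)); exact: continuous_horner.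
- exact: cvg_cst.
have [|B B0 hB] := @within_continuous_bounded R _ (- M) M (horner p).
  by apply: continuous_subspaceT; exact: continuous_horner.
exists B => t x y tM _ _; split.
- by apply: hB; rewrite in_itv/= -ler_norml.
- by rewrite normr0 ltW.
- by rewrite subrr mul0mx mxE subrr normr0 mulr_ge0 ?exprn_ge0// ltW.
Qed.

Lemma tame_coord (j : 'I_n) : tame (fun _ x => x j 0) (fun _ _ => delta_mx 0 j).
Proof.
split=> [s u _ uc t|s u _ _ t|M].
- by apply: cvg_mx_entry; exact: uc.
- exact: cvg_cst.
exists (Num.max M 1) => t x y _ xM _; split.
- by rewrite le_max (le_trans (normr_mxE _ _ _) xM).
- apply: mx_norm_le => [|i k]; first by rewrite le_max ler01 orbT.
  by rewrite mxE le_max; case: (_ && _); rewrite ?normr1 ?normr0 ?lexx ?ler01 orbT.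
- by rewrite -rowE !mxE subrr normr0 mulr_ge0 ?exprn_ge0// le_max ler01 orbT.
Qed.

Lemma norm_row_mul (v : 'rV[R]_n) (z : 'cV[R]_n) :
  `|(v *m z) 0 0| <= n%:R * `|v| * `|z|.
Proof. exact: le_trans (normr_mxE _ _ _) (norm_mulmx _ _). Qed.

(** The increment is its linear part plus the remainder, in which one of the two factors |y - x| is
    at most 2 M. *)
Lemma tame_lipschitz g D : tame g D -> forall M : R, exists2 L : R, 0 <= L &
  forall t x y, `|t| <= M -> `|x| <= M -> `|y| <= M ->
    `|g t y - g t x| <= L * `|y - x|.
Proof.
move=> [_ _ gM] M; have [K hK] := gM M.
exists (`|n%:R * K| + `|K * (M + M)|) => // t x y tM xM yM.
have [_ DK h] := hK t x y tM xM yM.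
have -> : g t y - g t x = (g t y - g t x - (D t x *m (y - x)) 0 0) + (D t x *m (y - x)) 0 0.
  by rewrite subrK.
apply: le_trans (ler_normD _ _) _; rewrite addrC mulrDl; apply: lerD.
  apply: le_trans (norm_row_mul _ _) _; apply: ler_wpM2r => //.
  by rewrite (le_trans _ (ler_norm _))// ler_wpM2l.
apply: le_trans h _; rewrite expr2 mulrA; apply: ler_wpM2r => //.
rewrite (le_trans _ (ler_norm _))// ler_wpM2l//.
  exact: le_trans (normr_ge0 _) DK.
by apply: le_trans (ler_normB _ _) _; rewrite lerD.
Qed.

Lemma tame_add g D h E : tame g D -> tame h E ->
  tame (fun t x => g t x + h t x) (fun t x => D t x + E t x).
Proof.
move=> [gc Dc gM] [hc Ec hM]; split=> [s u sc uc t|s u sc uc t|M].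
- by apply: cvgD; [exact: gc|exact: hc].
- by apply: cvgD; [exact: Dc|exact: Ec].
have [K hK] := gM M; have [K' hK'] := hM M.
exists (K + K') => t x y tM xM yM.
have [a1 a2 a3] := hK t x y tM xM yM; have [b1 b2 b3] := hK' t x y tM xM yM.
split.
- by apply: le_trans (ler_normD _ _) _; rewrite lerD.
- by apply: le_trans (ler_normD _ _) _; rewrite lerD.
- rewrite mulmxDl mx11D.
  rewrite mulrDl; apply: le_trans (lerD a3 b3); apply: le_trans (ler_normD _ _).
  by rewrite le_eqVlt; apply/orP; left; apply/eqP; congr `|_|; ring.
Qed.

(** The remainder of a product is g times the remainder of h, plus h times that of g, plus the
    product of the two increments, which is quadratic by the Lipschitz bounds. *)
Lemma tame_mul g D h E : tame g D -> tame h E ->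
  tame (fun t x => g t x * h t x) (fun t x => g t x *: E t x + h t x *: D t x).
Proof.
move=> gT hT; have gl := tame_lipschitz gT; have hl := tame_lipschitz hT.
move: gT hT => [gc Dc gM] [hc Ec hM]; split=> [s u sc uc t|s u sc uc t|M].
- by apply: cvgM; [exact: gc|exact: hc].
- by apply: cvgD; apply: cvgZ; [exact: gc|exact: Ec|exact: hc|exact: Dc].
have [K hK] := gM M; have [K' hK'] := hM M.
have [L L0 hL] := gl M; have [L' L'0 hL'] := hl M.
exists (K * K' + K' * K + L * L') => t x y tM xM yM.
have [a1 a2 a3] := hK t x y tM xM yM; have [b1 b2 b3] := hK' t x y tM xM yM.
have K0 := le_trans (normr_ge0 _) a1; have K'0 := le_trans (normr_ge0 _) b1.
have LL : 0 <= L * L' by exact: mulr_ge0.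
have KK : 0 <= K * K' by exact: mulr_ge0.
split.
- rewrite normrM; apply: (@le_trans _ _ (K * K')); first exact: ler_pM.
  by rewrite -addrA lerDl addr_ge0// mulrC.
- apply: le_trans (ler_normD _ _) _; rewrite !normrZ -[leLHS]addr0.
  apply: lerD; last exact: LL.
  by apply: lerD; apply: ler_pM.
- rewrite mulmxDl -!scalemxAl mx11D !mx11Z.
  have -> : g t y * h t y - g t x * h t x -
      (g t x * (E t x *m (y - x)) 0 0 + h t x * (D t x *m (y - x)) 0 0) =
    g t x * (h t y - h t x - (E t x *m (y - x)) 0 0) +
    h t x * (g t y - g t x - (D t x *m (y - x)) 0 0) +
    (g t y - g t x) * (h t y - h t x) by ring.
  apply: le_trans (ler_normD _ _) _; rewrite [leRHS]mulrDl; apply: lerD.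
    apply: le_trans (ler_normD _ _) _; rewrite [leRHS]mulrDl !normrM -!mulrA.
    by apply: lerD; apply: ler_pM.
  rewrite normrM expr2 mulrACA; apply: ler_pM => //.
    exact: hL.
  exact: hL'.
Qed.

Definition tameable g := exists D, tame g D.

Lemma tameable_sum I (r : seq I) (g : I -> R -> 'cV[R]_n -> R) :
  (forall i, tameable (g i)) -> tameable (fun t x => \sum_(i <- r) g i t x).
Proof.
move=> gT; elim: r => [|i r [D IH]].
  exists (fun _ _ => 0).
  have -> : (fun t x => \sum_(i <- [::]) g i t x) = (fun t _ => (0 : {poly R}).[t]).
    by apply/funext => t; apply/funext => x; rewrite big_nil horner0.
  exact: tame_horner.
have [E hE] := gT i; exists (fun t x => E t x + D t x).
have -> : (fun t x => \sum_(i <- i :: r) g i t x) =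
    (fun t x => g i t x + \sum_(i <- r) g i t x).
  by apply/funext => t; apply/funext => x; rewrite big_cons.
exact: tame_add.
Qed.

Lemma tameable_prod I (r : seq I) (g : I -> R -> 'cV[R]_n -> R) :
  (forall i, tameable (g i)) -> tameable (fun t x => \prod_(i <- r) g i t x).
Proof.
move=> gT; elim: r => [|i r [D IH]].
  exists (fun _ _ => 0).
  have -> : (fun t x => \prod_(i <- [::]) g i t x) = (fun t _ => (1 : {poly R}).[t]).
    by apply/funext => t; apply/funext => x; rewrite big_nil hornerE.
  exact: tame_horner.
have [E hE] := gT i.
exists (fun t x => g i t x *: D t x + (\prod_(i <- r) g i t x) *: E t x).
have -> : (fun t x => \prod_(i <- i :: r) g i t x) =
    (fun t x => g i t x * \prod_(i <- r) g i t x).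
  by apply/funext => t; apply/funext => x; rewrite big_cons.
exact: tame_mul.
Qed.

(** Powers are unrolled into products over [iota], so that closure under sums and products
    suffices. *)
Lemma tameable_meval (p : mpoly.mpoly n {poly R}) :
  tameable (fun t x => (mpoly.meval (fun j => (x j 0)%:P) p).[t]).
Proof.
have -> : (fun t (x : 'cV[R]_n) => (mpoly.meval (fun j => (x j 0)%:P) p).[t]) =
  (fun t x => \sum_(m <- mpoly.msupp p) (mpoly.mcoeff m p).[t] *
     \prod_(i <- index_enum 'I_n) \prod_(k <- iota 0 (mpoly.fun_of_multinom m i)) x i 0).
  apply/funext => t; apply/funext => x; rewrite mpoly.mevalE horner_sum.
  apply: eq_bigr => m _; rewrite hornerM; congr (_ * _).
  rewrite horner_prod; apply: eq_bigr => i _; rewrite horner_exp hornerC.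
  by rewrite big_const_seq count_predT size_iota iter_mulr mulr1.
apply: tameable_sum => m.
have [D hD] : tameable (fun t (x : 'cV[R]_n) =>
   \prod_(i <- index_enum 'I_n) \prod_(k <- iota 0 (mpoly.fun_of_multinom m i)) x i 0).
  by apply: tameable_prod => i; apply: tameable_prod => _; eexists; exact: tame_coord.
by eexists; apply: tame_mul (tame_horner _) hD.
Qed.

Lemma tame_derive g D t x j : tame g D -> 'D_(delta_mx j 0) (g t) x = D t x 0 j.
Proof.
move=> [_ _ gM]; apply/cvg_lim => //.
(* The extra 1 leaves room for the displaced point when |h| <= 1. *)
pose M := `|t| + (`|x| + 1).
have [K hK] := gM M.
apply/cvgrPdist_le => e e0.
have K1 : 0 < `|K| + 1 by rewrite ltr_wpDl.
have eK : 0 < e / (`|K| + 1) by exact: divr_gt0.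
near=> h.
have h0 : h != 0 by near: h; exact: nbhs_dnbhs_neq.
have h1 : `|h| <= 1 by near: h; apply: dnbhs0_le.
have he : `|h| <= e / (`|K| + 1) by near: h; exact: dnbhs0_le.
have xM : `|x| <= M by rewrite /M addrCA lerDl addr_ge0.
have tM : `|t| <= M by rewrite /M lerDl addr_ge0.
have de : `|delta_mx j 0 : 'cV[R]_n| <= 1.
  apply: mx_norm_le => // i k; rewrite mxE.
  by case: (_ && _); rewrite ?normr1 ?normr0 ?lexx ?ler01.
have yM : `|h *: delta_mx j 0 + x| <= M.
  apply: le_trans (ler_normD _ _) _; rewrite normrZ /M addrCA addrC.
  by rewrite lerD// (le_trans _ (_ : 0 + 1 <= _)) ?lerD// add0r mulr_ile1.
have [_ _] := hK t x _ tM xM yM; rewrite addrK.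
rewrite -scalemxAr -colE mxE [col _ _ _ _]mxE normrZ => hh.
rewrite -(ler_pM2l (_ : 0 < `|h|)) ?normr_gt0// -normrM mulrBr mulrA mulfV// mul1r.
rewrite -normrN opprB; apply: le_trans hh _.
rewrite exprMn expr2 -mulrA mulrCA; apply: ler_wpM2l => //.
have d1 : `|delta_mx j 0 : 'cV[R]_n| ^+ 2 <= 1 by rewrite expr_le1.
apply: (@le_trans _ _ (`|K| * (e / (`|K| + 1)))).
  apply: (@le_trans _ _ (`|K| * `|h|)); last exact: ler_wpM2l.
  apply: le_trans (_ : `|K| * (`|h| * 1) <= _); last by rewrite mulr1.
  apply: (@le_trans _ _ (`|K| * (`|h| * `|delta_mx j 0 : 'cV[R]_n| ^+ 2))).
    by apply: ler_wpM2r; [rewrite mulr_ge0// exprn_ge0|exact: ler_norm].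
  by apply: ler_wpM2l => //; exact: ler_wpM2l.
rewrite mulrCA ler_piMr ?(ltW e0)//.
by rewrite ler_pdivrMr// mul1r lerDl.
Unshelve. all: by end_near. Qed.

End Tame.

Section TameField.
Context {R : realType} (n : nat).
Implicit Types (G : R -> 'cV[R]_n -> 'cV[R]_n) (J : R -> 'cV[R]_n -> 'M[R]_n).

Definition tame_field G J : Prop :=
  forall i, tame (fun t x => G t x i 0) (fun t x => row i (J t x)).

Lemma tame_field_poly (p : 'I_n -> mpoly.mpoly n {poly R}) :
  exists G J, tame_field G J /\ forall t x i,
    G t x i 0 = (mpoly.meval (fun j => (x j 0)%:P) (p i)).[t].
Proof.
have [D hD] := choice (fun i => tameable_meval (p i)).
exists (fun t x => \col_i (mpoly.meval (fun j => (x j 0)%:P) (p i)).[t]).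
exists (fun t x => \matrix_(i, j) D i t x 0 j).
split=> [i|t x i]; last by rewrite mxE.
have -> : (fun t x => row i (\matrix_(i0, j) D i0 t x 0 j)) = D i.
  apply/funext => t; apply/funext => x; apply/rowP => j.
  by rewrite !mxE.
under eq_fun do under eq_fun do rewrite mxE.
exact: hD.
Qed.

Lemma tame_field_continuous G J (s : R -> R) (u : R -> 'cV[R]_n) :
  tame_field G J -> continuous s -> continuous u ->
  continuous (fun t => G (s t) (u t)).
Proof.
move=> h sc uc t; apply/cvg_mxP => i j; rewrite ord1.
by have [+ _ _] := h i; move=> /(_ s u sc uc t).
Qed.

Lemma tame_field_jac_continuous G J (s : R -> R) (u : R -> 'cV[R]_n) :
  tame_field G J -> continuous s -> continuous u ->
  continuous (fun t => J (s t) (u t)).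
Proof.
move=> h sc uc t; apply/cvg_mxP => i j.
have [_ + _] := h i => /(_ s u sc uc t)/(cvg_mx_entry (i := 0) (j := j)).
by rewrite mxE; under eq_fun do rewrite mxE.
Qed.

Lemma tame_field_taylor G J : tame_field G J -> forall M : R, exists2 K : R, 0 <= K &
  forall t x y, `|t| <= M -> `|x| <= M -> `|y| <= M ->
   [/\ `|G t x| <= K, `|J t x| <= K &
    `|G t y - G t x - J t x *m (y - x)| <= K * `|y - x| ^+ 2].
Proof.
move=> h M; have hM i : exists K, forall t x y, `|t| <= M -> `|x| <= M -> `|y| <= M ->
   [/\ `|G t x i 0| <= K, `|row i (J t x)| <= K &
    `|G t y i 0 - G t x i 0 - (row i (J t x) *m (y - x)) 0 0| <= K * `|y - x| ^+ 2].
  by have [_ _] := h i; exact.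
have [K hK] := choice hM.
have K0 : 0 <= \sum_i `|K i| by exact: sumr_ge0.
have KK i : K i <= \sum_i `|K i|.
  by rewrite (bigD1 i)//= (le_trans (ler_norm _))// lerDl sumr_ge0.
exists (\sum_i `|K i|) => // t x y tM xM yM; split; apply: mx_norm_le => //.
- move=> i j; rewrite ord1; have [h1 _ _] := hK i t x y tM xM yM.
  exact: le_trans h1 (KK i).
- move=> i j; have [_ h1 _] := hK i t x y tM xM yM.
  apply: le_trans (le_trans h1 (KK i)).
  by have := normr_mxE (row i (J t x)) 0 j; rewrite mxE.
- by rewrite mulr_ge0// exprn_ge0.
- move=> i j; rewrite ord1; have [_ _ h1] := hK i t x y tM xM yM.
  apply: le_trans (le_trans h1 _); last by rewrite ler_wpM2r// exprn_ge0.
  by rewrite -row_mul !mxE in h1 *.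
Qed.

Lemma tame_field_jacobian G J t x : tame_field G J -> jacobian_cv (G t) x = J t x.
Proof.
by move=> h; apply/matrixP => i j; rewrite mxE (tame_derive _ _ _ (h i)) mxE.
Qed.

Lemma tame_field_lipschitz G J : tame_field G J -> forall M : R, exists2 L : R, 0 <= L &
  forall t x y, `|t| <= M -> `|x| <= M -> `|y| <= M ->
    `|G t y - G t x| <= L * `|y - x|.
Proof.
move=> h M; have hM i : exists L : R, 0 <= L /\ forall t x y, `|t| <= M -> `|x| <= M ->
    `|y| <= M -> `|G t y i 0 - G t x i 0| <= L * `|y - x|.
  by have [L L0 hL] := tame_lipschitz (h i) M; exists L.
have [L hL] := choice hM.
have L0 : 0 <= \sum_i L i by apply: sumr_ge0 => i _; have [] := hL i.
exists (\sum_i L i) => // t x y tM xM yM; apply: mx_norm_le; first exact: mulr_ge0.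
move=> i j; rewrite ord1 !mxE; have [_ h1] := hL i.
apply: le_trans (h1 _ _ _ tM xM yM) _; rewrite ler_wpM2r//.
by rewrite (bigD1 i)//= lerDl; apply: sumr_ge0 => k _; have [] := hL k.
Qed.

Lemma clamp_norm (a b t : R) : a <= b -> `|clamp a b t| <= `|a| + `|b|.
Proof.
move=> ab; have := clamp_itv t ab; rewrite in_itv/= => /andP[h1 h2].
have := ler_norm b; have := ler_norm (- a); rewrite normrN => ha hb.
have := normr_ge0 a; have := normr_ge0 b => b0 a0.
by rewrite ler_norml; apply/andP; split; lra.
Qed.

(** Balls of the entrywise norm are cubes, so clamping each coordinate is a 1-Lipschitz retraction
    onto the ball of radius M. *)
Definition clamp_mx (M : R) (x : 'cV[R]_n) : 'cV[R]_n := map_mx (clamp (- M) M) x.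

Lemma clamp_mxE (M : R) x : `|x| <= M -> clamp_mx M x = x.
Proof.
move=> xM; apply/matrixP => i j; rewrite mxE clampE// in_itv/= -ler_norml.
exact: le_trans (normr_mxE _ _ _) xM.
Qed.

Lemma norm_clamp_mx (M : R) x : 0 <= M -> `|clamp_mx M x| <= M.
Proof.
move=> M0; apply: mx_norm_le => // i j; rewrite mxE.
have := @clamp_itv R (- M) M (x i j); rewrite in_itv/= -ler_norml; apply; lra.
Qed.

Lemma clamp_mx_dist (M : R) x y : `|clamp_mx M x - clamp_mx M y| <= `|x - y|.
Proof.
apply: mx_norm_le => // i j; rewrite !mxE.
by apply: le_trans (clamp_dist _ _ _ _) _; have := normr_mxE (x - y) i j; rewrite !mxE.
Qed.

(** A polynomial field is only locally Lipschitz; clamping time and state confines it to a bounded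
    set, where its local constants are global. *)
Lemma regular_clamped G J (a b M : R) : a <= b -> 0 <= M -> tame_field G J ->
  regular_field (fun t x => G (clamp a b t) (clamp_mx M x)).
Proof.
move=> ab M0 h; pose T := `|a| + `|b| + M.
have cT t : `|clamp a b t| <= T by rewrite (le_trans (clamp_norm t ab))// lerDl.
have xT x : `|clamp_mx M x| <= T.
  by rewrite (le_trans (norm_clamp_mx x M0))// lerDr addr_ge0.
split=> [u uc||x].
- apply: (tame_field_continuous h) => [|t]; first exact: continuous_clamp.
  apply/cvg_mxP => i j; rewrite mxE; under eq_fun do rewrite mxE.
  apply: (@continuous_comp _ _ _ (fun t => u t i j)); last exact: continuous_clamp.
  by apply: cvg_mx_entry; exact: uc.
- have [L L0 hL] := tame_field_lipschitz h T.
  exists L => t x y; apply: le_trans (hL _ _ _ (cT t) (xT y) (xT x)) _.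
  by rewrite ler_wpM2l// clamp_mx_dist.
- have [K K0 hK] := tame_field_taylor h T.
  by exists K => t; have [] := hK _ _ _ (cT t) (xT x) (xT x).
Qed.

(** The linearization along [x0], whose forward flow gives the lower bound on the Lyapunov solution.
    Clamping time is enough, the field being linear in the state. *)
Lemma regular_linear G J (a b : R) (x0 : R -> 'cV[R]_n) : a <= b -> tame_field G J ->
  {within `[a, b], continuous x0} ->
  regular_field (fun t x => J (clamp a b t) (x0 (clamp a b t)) *m x).
Proof.
move=> ab h x0c.
have [X X0 hX] := within_continuous_bounded x0c.
pose T := `|a| + `|b| + X.
have cT t : `|clamp a b t| <= T.
  by rewrite (le_trans (clamp_norm t ab))// lerDl ltW.
have xT t : `|x0 (clamp a b t)| <= T.
  by rewrite (le_trans (hX _ (clamp_itv t ab)))// lerDr addr_ge0.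
have [K K0 hK] := tame_field_taylor h T.
have JK t : `|J (clamp a b t) (x0 (clamp a b t))| <= K.
  by have [] := hK _ _ _ (cT t) (xT t) (xT t).
have bnd t x : `|J (clamp a b t) (x0 (clamp a b t)) *m x| <= n%:R * K * `|x|.
  by apply: le_trans (norm_mulmx _ _) _; rewrite ler_wpM2r// ler_wpM2l.
split=> [u uc t||x].
- apply: cvg_mulmx; last exact: uc.
  apply: (tame_field_jac_continuous h); first exact: continuous_clamp.
  exact: (within_clamp x0 ab).1.
- by exists (n%:R * K) => t x y; rewrite -mulmxBr; exact: bnd.
- by exists (n%:R * K * `|x|) => t; exact: bnd.
Qed.

End TameField.

(** * Quadratic forms and the Lyapunov equation *)

Section QuadraticForms.
Context {R : realType} (n : nat).
Implicit Types (P Q : 'M[R]_n) (x y z : 'cV[R]_n).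

(** The polarization of [qform]: [qform P x] and [bform P x x] are convertible, which later
    rewritings exploit. *)
Definition bform P x y : R := (x^T *m P *m y) 0 0.

Lemma bformDl P x y z : bform P (x + y) z = bform P x z + bform P y z.
Proof. by rewrite /bform linearD/= !mulmxDl mxE. Qed.

Lemma bformDr P x y z : bform P x (y + z) = bform P x y + bform P x z.
Proof. by rewrite /bform mulmxDr mxE. Qed.

Lemma bformZl P a x y : bform P (a *: x) y = a * bform P x y.
Proof. by rewrite /bform linearZ/= -!scalemxAl mxE. Qed.

Lemma bformZr P a x y : bform P x (a *: y) = a * bform P x y.
Proof. by rewrite /bform -scalemxAr mxE. Qed.

Lemma bformNl P x y : bform P (- x) y = - bform P x y.
Proof. by rewrite -scaleN1r bformZl mulN1r. Qed.

Lemma bformNr P x y : bform P x (- y) = - bform P x y.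
Proof. by rewrite -scaleN1r bformZr mulN1r. Qed.

Lemma bform_mxD P Q x y : bform (P + Q) x y = bform P x y + bform Q x y.
Proof. by rewrite /bform mulmxDr mulmxDl mxE. Qed.

Lemma bform_mxZ P a x y : bform (a *: P) x y = a * bform P x y.
Proof. by rewrite /bform -scalemxAr -scalemxAl mxE. Qed.

Lemma bform_mxN P x y : bform (- P) x y = - bform P x y.
Proof. by rewrite -scaleN1r bform_mxZ mulN1r. Qed.

Lemma bform_mull P Q x y : bform (P^T *m Q) x y = bform Q (P *m x) y.
Proof. by rewrite /bform trmx_mul !mulmxA. Qed.

Lemma bform_mulr P Q x y : bform (P *m Q) x y = bform P x (Q *m y).
Proof. by rewrite /bform !mulmxA. Qed.

Lemma bform_trmx P x y : bform P^T x y = bform P y x.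
Proof.
rewrite /bform -[in LHS](trmxK (x^T *m P^T *m y)) mxE.
by rewrite !trmx_mul !trmxK mulmxA.
Qed.

Lemma bformC P x y : P^T = P -> bform P x y = bform P y x.
Proof. by move=> PT; rewrite -bform_trmx PT. Qed.

Lemma norm_bform P x y : `|bform P x y| <= n%:R ^+ 2 * `|P| * `|x| * `|y|.
Proof.
apply: le_trans (normr_mxE _ _ _) _; apply: le_trans (norm_mulmx _ _) _.
apply: ler_wpM2r => //; apply: le_trans (ler_wpM2l _ (norm_mulmx _ _)) _ => //.
by rewrite norm_trmx le_eqVlt; apply/orP; left; apply/eqP; ring.
Qed.

(** The squared Euclidean norm has each squared entry as a summand, and the norm on the left is the
    largest entry in absolute value. *)
Lemma qform1_ge x : `|x| ^+ 2 <= qform 1%:M x.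
Proof.
have q i : x i 0 ^+ 2 <= qform 1%:M x.
  rewrite /qform mulmx1 mxE (bigD1 i)//= mxE -expr2 lerDl.
  by apply: sumr_ge0 => k _; rewrite mxE -expr2 sqr_ge0.
have q0 : 0 <= qform 1%:M x.
  by rewrite /qform mulmx1 mxE; apply: sumr_ge0 => k _; rewrite mxE -expr2 sqr_ge0.
rewrite -(sqr_sqrtr q0); apply: lerXn2r; rewrite ?nnegrE ?sqrtr_ge0//.
apply: mx_norm_le => [|i j]; first exact: sqrtr_ge0.
by rewrite ord1 -sqrtr_sqr ler_wsqrtr.
Qed.

Lemma qform1_le x : qform 1%:M x <= n%:R * `|x| ^+ 2.
Proof.
rewrite /qform mulmx1; apply: le_trans (ler_norm _) _.
apply: le_trans (normr_mxE _ _ _) _; apply: le_trans (norm_mulmx _ _) _.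
by rewrite norm_trmx expr2 mulrA.
Qed.

Lemma symposdef_ge0 P x : symposdef P -> 0 <= qform P x.
Proof.
move=> [_ Pp]; have [->|/Pp/ltW//] := eqVneq x 0.
by rewrite /qform trmx0 !mul0mx mxE.
Qed.

(** Cauchy-Schwarz, from the nonnegativity of the form at P(x, x) y - P(x, y) x. *)
Lemma bform_cauchy P x y : symposdef P ->
  bform P x y ^+ 2 <= qform P x * qform P y.
Proof.
move=> Ps; have [PT Pp] := Ps; have [->|x0] := eqVneq x 0.
  by rewrite /bform/qform !trmx0 !mul0mx !mxE expr0n/= mul0r.
have q0 := Pp _ x0; rewrite -(ler_pM2l q0).
have := symposdef_ge0 (qform P x *: y - bform P x y *: x) Ps.
rewrite [X in 0 <= X -> _]/qform -/(bform _ _ _).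
rewrite !(bformDl, bformDr, bformNl, bformNr, bformZl, bformZr).
rewrite (bformC y x PT) -/(qform P x) -[bform P x x]/(qform P x) -[bform P y y]/(qform P y).
lra.
Qed.

Lemma symposdef_unit P : symposdef P -> P \in unitmx.
Proof.
move=> [PT Pp]; rewrite -row_free_unit -kermx_eq0; apply/eqP/eqP.
apply/negPn/negP => /rowV0Pn[v /sub_kermxP vP v0].
have := Pp v^T; rewrite /qform trmxK vP mul0mx mxE ltxx => h.
by have := h _; rewrite trmx_eq0 => /(_ v0).
Qed.

(** Cauchy-Schwarz bounds each coordinate of [z], which avoids eigenvalues and compactness of the
    sphere. Adding 1 to [C] keeps the constant invertible when n = 0. *)
Lemma symposdef_bound P : symposdef P ->
  exists2 m : R, 0 < m & forall z, m * `|z| ^+ 2 <= qform P z.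
Proof.
move=> Ps; have [PT Pp] := Ps; have Pu := symposdef_unit Ps.
have P0 z : 0 <= qform P z by exact: symposdef_ge0.
(* z i is the P-inner product of z and P^-1 e_i *)
pose w (i : 'I_n) : 'cV[R]_n := invmx P *m delta_mx i 0.
pose C := \sum_i qform P (w i).
have C0 : 0 <= C by apply: sumr_ge0.
exists (C + 1)^-1; first by rewrite invr_gt0 ltr_wpDl.
move=> z; rewrite mulrC ler_pdivrMr ?ltr_wpDl//.
have zi i : z i 0 ^+ 2 <= qform P z * (C + 1).
  have -> : z i 0 = bform P z (w i).
    rewrite bformC// /bform /w trmx_mul trmx_inv PT -mulmxA.
    rewrite -mulmxA (mulmxA (invmx P)) mulVmx// mul1mx trmx_delta -rowE mxE.
    by [].
  apply: le_trans (bform_cauchy _ _ Ps) _; apply: ler_wpM2l => //.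
  rewrite /C (bigD1 i)//= -addrA lerDl addr_ge0// sumr_ge0//.
have q0 : 0 <= qform P z * (C + 1) by rewrite mulr_ge0// addr_ge0.
rewrite -(sqr_sqrtr q0); apply: lerXn2r; rewrite ?nnegrE ?sqrtr_ge0//.
apply: mx_norm_le => [|i j]; first exact: sqrtr_ge0.
by rewrite ord1 -sqrtr_sqr ler_wsqrtr.
Qed.

Lemma is_derive_qform (P : R -> 'M[R]_n) (z : R -> 'cV[R]_n) (t : R) dP dz :
  is_derive t 1 P dP -> is_derive t 1 z dz ->
  is_derive t (1 : R) (fun s => qform (P s) (z s))
    (bform (P t) dz (z t) + bform dP (z t) (z t) + bform (P t) (z t) dz).
Proof.
move=> hP hz.
have := is_derive_mx_entry 0 0
  (is_derive_mulmx (is_derive_mulmx (is_derive_trmx hz) hP) hz).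
by rewrite mulmxDl !mx11D.
Qed.

Lemma cvg_qform T (F : set_system T) {FF : Filter F} (P : T -> 'M[R]_n)
    (z : T -> 'cV[R]_n) (P' : 'M[R]_n) (z' : 'cV[R]_n) :
  P @ F --> P' -> z @ F --> z' -> (fun s => qform (P s) (z s)) @ F --> qform P' z'.
Proof.
move=> hP hz; apply: cvg_mx_entry; apply: cvg_mulmx => //.
by apply: cvg_mulmx => //; exact: cvg_trmx.
Qed.

End QuadraticForms.

Section Lyapunov.
Context {R : realType} (n : nat).

(** The squared Euclidean norm of y decays at logarithmic rate at most L = 2 n^2 k, so its product
    with exp(L (t - a)) is nondecreasing. *)
Lemma linear_flow_lower (S : seq R) (a b k : R) (A : R -> 'M[R]_n) (y : R -> 'cV[R]_n) :
  a <= b -> {within `[a, b], continuous y} ->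
  (forall t, t \in `]a, b[ -> t \notin S -> is_derive t 1 y (A t *m y t)) ->
  (forall t, t \in `]a, b[ -> t \notin S -> `|A t| <= k) ->
  expR (- (2 * n%:R ^+ 2 * k * (b - a))) * qform 1%:M (y a) <= qform 1%:M (y b).
Proof.
move=> ab yc yd Ak; pose L := 2 * n%:R ^+ 2 * k.
pose E (t : R) := expR (L * (t - a)).
have Ed t : is_derive t (1 : R) E (L * E t) by exact: is_derive_expRM.
have yq : {within `[a, b], continuous (fun t => qform 1%:M (y t))}.
  by move=> t; apply: cvg_qform; [exact: cvg_cst|exact: yc].
have Ec : {within `[a, b], continuous E}.
  apply: continuous_subspaceT => t; apply/differentiable_continuous/derivable1_diffP.
  by have [] := Ed t.
have h : - (E b * qform 1%:M (y b)) <= - (E a * qform 1%:M (y a)).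
  apply: (@nonincreasing_off _ S a b (fun t => - (E t * qform 1%:M (y t)))) => //.
    by move=> t; apply: cvgN; apply: cvgM; [exact: Ec|exact: yq].
  move=> t tab tS.
  have hy := is_derive_qform (is_derive_cst (1%:M : 'M[R]_n) t 1) (yd t tab tS).
  eexists; first exact: (is_deriveN (is_deriveM (Ed t) hy)).
  rewrite /GRing.scale/= oppr_le0.
  set bb := bform _ _ _ + _ + _.
  have -> : bb = 2 * bform 1%:M (A t *m y t) (y t).
    rewrite /bb (bformC (y t))// ?trmx1//.
    have -> : bform 0 (y t) (y t) = 0 by rewrite /bform mulmx0 mul0mx mxE.
    by rewrite addr0; lra.
  have : `|bform 1%:M (A t *m y t) (y t)| <= n%:R ^+ 2 * k * qform 1%:M (y t).
    rewrite /bform mulmx1; apply: le_trans (normr_mxE _ _ _) _.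
    apply: le_trans (norm_mulmx _ _) _; rewrite norm_trmx.
    apply: (@le_trans _ _ (n%:R * (n%:R * k * `|y t|) * `|y t|)).
      apply: ler_wpM2r => //; apply: ler_wpM2l => //.
      apply: le_trans (norm_mulmx _ _) _; apply: ler_wpM2r => //.
      by apply: ler_wpM2l => //; exact: Ak.
    have -> : n%:R * (n%:R * k * `|y t|) * `|y t| = n%:R ^+ 2 * k * `|y t| ^+ 2 by ring.
    apply: ler_wpM2l; last exact: qform1_ge.
    by rewrite mulr_ge0 ?exprn_ge0// (le_trans _ (Ak t tab tS)).
  move=> /ler_normlP[hb _].
  have -> : E t * (2 * bform 1%:M (A t *m y t) (y t)) + qform 1%:M (y t) * (L * E t) =
    E t * (2 * (bform 1%:M (A t *m y t) (y t) + n%:R ^+ 2 * k * qform 1%:M (y t))).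
    by rewrite /L; ring.
  apply: mulr_ge0; first exact: expR_ge0.
  by apply: mulr_ge0 => //; lra.
move: h; rewrite lerN2 /E subrr mulr0 expR0 mul1r => h.
by rewrite expRN mulrC ler_pdivrMr ?expR_gt0// mulrC.
Qed.

Lemma lyapunov_lower (S : seq R) (a b k : R) (A Q P : R -> 'M[R]_n) :
  a <= b -> symposdef (P b) -> {within `[a, b], continuous P} ->
  (forall t, t \in `]a, b[ -> t \notin S ->
     is_derive t 1 P (- ((A t)^T *m P t + P t *m A t + Q t))) ->
  (forall t, t \in `]a, b[ -> t \notin S -> `|A t| <= k) ->
  (forall t z, t \in `]a, b[ -> 0 <= qform (Q t) z) ->
  (forall s z, s \in `[a, b] -> exists y : R -> 'cV[R]_n,
    [/\ continuous y, y s = z & exists S' : seq R, forall t, t \in `]s, b[ -> t \notin S' ->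
     is_derive t 1 y (A t *m y t)]) ->
  exists2 m : R, 0 < m & forall t z, t \in `[a, b] -> m * `|z| ^+ 2 <= qform (P t) z.
Proof.
move=> ab Pb Pc Pd Ak Q0 flow.
have [m m0 hm] := symposdef_bound Pb.
(* The absolute value makes the exponent monotone in the length of the interval, so that [e] serves
   every starting time in [a, b]. *)
pose e := expR (- (2 * n%:R ^+ 2 * `|k| * (b - a))).
have n0 : 0 < n%:R + 1 :> R by rewrite ltr_wpDl.
(* Passing from the Euclidean to the entrywise norm costs a factor n; n + 1 stays positive when n =
   0. *)
exists (m / (n%:R + 1) * e); first by rewrite mulr_gt0 ?expR_gt0// divr_gt0.
move=> s z sab; have [y [yc ys [S' yd]]] := flow s z sab.
have /andP[as_ sb] : a <= s <= b by move: sab; rewrite in_itv.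
have sub t : t \in `]s, b[ -> t \in `]a, b[.
  by rewrite !in_itv/= => /andP[st ->]; rewrite (le_lt_trans as_ st).
have h1 : qform (P b) (y b) <= qform (P s) (y s).
  apply: (@nonincreasing_off _ (S ++ S') s b (fun t => qform (P t) (y t))) => //.
    have Pc' := within_sub as_ (lexx b) Pc.
    move=> t; apply: cvg_qform; first exact: Pc'.
    by apply: continuous_subspaceT; exact: yc.
  move=> t tsb; rewrite mem_cat negb_or => /andP[tS tS'].
  eexists; first exact: is_derive_qform (Pd t (sub t tsb) tS) (yd t tsb tS').
  (* The terms in [A] cancel and - Q(y, y) remains. *)
  rewrite bform_mxN !bform_mxD bform_mull bform_mulr.
  have := Q0 t (y t) (sub t tsb); rewrite /qform -/(bform _ _ _); lra.
have h2 : e * qform 1%:M (y s) <= qform 1%:M (y b).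
  have yc' : {within `[s, b], continuous y} by exact: continuous_subspaceT.
  have yd' t : t \in `]s, b[ -> t \notin S ++ S' -> is_derive t 1 y (A t *m y t).
    by rewrite mem_cat negb_or => tsb /andP[_]; exact: yd.
  have Ak' t : t \in `]s, b[ -> t \notin S ++ S' -> `|A t| <= `|k|.
    rewrite mem_cat negb_or => tsb /andP[tS _].
    exact: le_trans (Ak t (sub t tsb) tS) (ler_norm k).
  apply: le_trans (linear_flow_lower sb yc' yd' Ak'); apply: ler_wpM2r.
    exact: le_trans (exprn_ge0 2 (normr_ge0 _)) (qform1_ge _).
  rewrite ler_expR lerN2; apply: ler_wpM2l; last by rewrite lerB.
  by rewrite !mulr_ge0// exprn_ge0.
have h3 := hm (y b).
have mn : 0 <= m / (n%:R + 1) by rewrite divr_ge0// ltW.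
rewrite -ys; apply: le_trans (le_trans h3 h1).
rewrite -[_ * e * _]mulrA.
apply: (@le_trans _ _ (m / (n%:R + 1) * (e * qform 1%:M (y s)))).
  apply: ler_wpM2l => //; apply: ler_wpM2l; first exact: expR_ge0.
  exact: qform1_ge.
apply: (@le_trans _ _ (m / (n%:R + 1) * (n%:R * `|y b| ^+ 2))).
  by apply: ler_wpM2l => //; exact: le_trans h2 (qform1_le _).
rewrite -!mulrA; apply: ler_wpM2l; first exact: ltW.
rewrite mulrA ler_piMl ?exprn_ge0// mulrC ler_pdivrMr// mul1r.
by rewrite lerDl.
Qed.

End Lyapunov.

Lemma cvg_subr_cst (R : realType) (W : normedModType R) (c x : W) :
  (fun y => y - c) @ x --> x - c.
Proof. by apply: cvgB; [exact: cvg_id|exact: cvg_cst]. Qed.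

(** * Decay rate on the band, and spatial derivatives of the quadratic form *)

Section Estimate.
Context {R : realType} (n : nat).

(** Pointwise form of the decay: [w] is the velocity of [z], [e] the exponential weight and - k its
    logarithmic derivative. As V >= 1/2, the damping is at least k / 2, and the threshold on [k]
    makes this exceed the cubic error by 1. The remainder bound is asked only for |z| <= rho, so [K]
    can be fixed before [k] and [e]. *)
Lemma bform_estimate (P Q A : 'M[R]_n) (w z : 'cV[R]_n) (m p K k e : R) :
  0 < m -> 0 <= p -> 0 <= K -> 1 <= e ->
  `|P| <= p -> m * `|z| ^+ 2 <= qform P z -> 0 <= qform Q z ->
  (`|z| <= Num.sqrt (2 / m) -> `|w - A *m z| <= K * `|z| ^+ 2) ->
  2 * (2 * n%:R ^+ 2 * p * K * Num.sqrt (2 / m) ^+ 3 + 1) <= k ->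
  2^-1 <= qform (e *: P) z -> qform (e *: P) z <= 2 ->
  bform (e *: P) w z
  + bform ((- k * e) *: P + e *: - (A^T *m P + P *m A + Q)) z z
  + bform (e *: P) z w <= - 1.
Proof.
move=> m0 p0 K0 e1 Pp mz Qz rz kC V1 V2.
set rho := Num.sqrt _ in rz kC.
have rho2 : rho ^+ 2 = 2 / m by rewrite sqr_sqrtr// divr_ge0// ltW.
have rho0 : 0 <= rho by exact: sqrtr_ge0.
have e0 : 0 < e by exact: lt_le_trans e1.
have VE : qform (e *: P) z = e * qform P z by exact: bform_mxZ.
set q := qform P z in mz VE; rewrite VE in V1 V2.
have q0 : 0 <= q by apply: le_trans mz; rewrite mulr_ge0 ?exprn_ge0// ltW.
have qe : q <= e * q by rewrite ler_peMl.
have zr2 : e * `|z| ^+ 2 <= rho ^+ 2.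
  rewrite rho2 ler_pdivlMr// mulrC mulrCA.
  by apply: le_trans V2; rewrite ler_wpM2l// ltW.
have zr : `|z| <= rho.
  rewrite -(ler_pXn2r (n := 2))// ?nnegrE//; apply: le_trans zr2.
  by rewrite ler_peMl// exprn_ge0.
set r := w - A *m z in rz; have {}rz := rz zr.
have wE : w = A *m z + r by rewrite addrC subrK.
clearbody r.
(* Two factors |z| absorb the weight through V <= 2 and the third is at most rho, so the bound does
   not involve [e]. *)
have zr3 : e * `|z| ^+ 3 <= rho ^+ 3.
  rewrite exprS mulrCA (exprS rho); apply: ler_pM => //.
  by rewrite mulr_ge0 ?exprn_ge0// ltW.
have rb : `|r| * `|z| <= K * `|z| ^+ 3.
  by rewrite exprSr mulrA ler_wpM2r.
have n0 : 0 <= n%:R ^+ 2 * p by rewrite mulr_ge0// exprn_ge0.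
have hrz : n%:R ^+ 2 * `|P| * (`|r| * `|z|) <= n%:R ^+ 2 * p * (K * `|z| ^+ 3).
  apply: ler_pM; [|by rewrite mulr_ge0| |exact: rb].
    by rewrite mulr_ge0// exprn_ge0.
  by rewrite ler_wpM2l// exprn_ge0.
have h1 : `|bform P r z| <= n%:R ^+ 2 * p * (K * `|z| ^+ 3).
  apply: le_trans (norm_bform _ _ _) _; rewrite -mulrA; exact: hrz.
have h2 : `|bform P z r| <= n%:R ^+ 2 * p * (K * `|z| ^+ 3).
  apply: le_trans (norm_bform _ _ _) _; rewrite -mulrA (mulrC `|z|); exact: hrz.
rewrite wE !(bformDl, bformDr, bform_mxD, bform_mxZ, bform_mxN) bform_mull bform_mulr.
rewrite -[bform P z z]/q -[bform Q z z]/(qform Q z).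
have hN : n%:R ^+ 2 * p * (K * (e * `|z| ^+ 3)) <= n%:R ^+ 2 * p * (K * rho ^+ 3).
  by apply: ler_wpM2l => //; apply: ler_wpM2l.
have h : e * (bform P r z + bform P z r) <= 2 * (n%:R ^+ 2 * p * (K * rho ^+ 3)).
  apply: (@le_trans _ _ (e * (2 * (n%:R ^+ 2 * p * (K * `|z| ^+ 3))))).
    rewrite ler_pM2l//; move: h1 h2 => /ler_normlP[_ a1] /ler_normlP[_ a2]; lra.
  have -> : e * (2 * (n%:R ^+ 2 * p * (K * `|z| ^+ 3))) =
    2 * (n%:R ^+ 2 * p * (K * (e * `|z| ^+ 3))) by ring.
  by rewrite ler_pM2l.
have hQ : 0 <= e * qform Q z by rewrite mulr_ge0// ltW.
have k0 : 0 <= k.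
  apply: le_trans kC; rewrite mulr_ge0// addr_ge0//.
  by rewrite !mulr_ge0// ?exprn_ge0// mulr_ge0.
have hk : k * 2^-1 <= k * (e * q) by rewrite ler_wpM2l.
have e2 : 2 * (2 * n%:R ^+ 2 * p * K * rho ^+ 3 + 1) =
  2 * (2 * (n%:R ^+ 2 * p * (K * rho ^+ 3))) + 2 by ring.
rewrite e2 in kC.
set X := 2 * (n%:R ^+ 2 * p * (K * rho ^+ 3)) in h kC.
set b1 := bform P (A *m z) z; set b2 := bform P z (A *m z).
set r1 := bform P r z in h *; set r2 := bform P z r in h *.
have -> : e * (b1 + r1) + (- k * e * q + e * - (b1 + b2 + qform Q z)) + e * (b2 + r2)
  = e * (r1 + r2) - k * (e * q) - e * qform Q z by ring.
lra.
Qed.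

Lemma qform_line (P : 'M[R]_n) (z v : 'cV[R]_n) (h : R) :
  qform P (h *: v + z) = qform P z + h * (bform P v z + bform P z v) + h ^+ 2 * qform P v.
Proof.
rewrite [LHS]/qform -/(bform _ _ _) !(bformDl, bformDr, bformZl, bformZr).
by rewrite -[bform P z z]/(qform P z) -[bform P v v]/(qform P v); ring.
Qed.

Lemma derive_qform (P : 'M[R]_n) (c x v : 'cV[R]_n) :
  'D_v (fun x => qform P (x - c)) x = bform P v (x - c) + bform P (x - c) v.
Proof.
apply/cvg_lim => //.
set D := bform P v (x - c) + bform P (x - c) v.
(* For h != 0 this affine function is exactly the difference quotient. *)
have : (fun h : R => D + h * qform P v) @ 0^' --> D + 0 * qform P v.
  apply: cvgD; first exact: cvg_cst.
  by apply: cvgM; [exact: nbhs_dnbhs|exact: cvg_cst].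
rewrite mul0r addr0; apply: cvg_trans; apply: near_eq_cvg; near=> h.
have h0 : h != 0 by near: h; exact: nbhs_dnbhs_neq.
rewrite /= -(addrA (h *: v)) qform_line /D /GRing.scale/=.
by field.
Unshelve. all: by end_near. Qed.

(** The symmetry of the Lyapunov solution before the final time is not established, hence [P + P^T]
    instead of twice [P]. *)
Lemma gradient_qform (P : 'M[R]_n) (c x : 'cV[R]_n) :
  gradient (fun x => qform P (x - c)) x = (x - c)^T *m (P + P^T).
Proof.
apply/rowP => j; rewrite mxE derive_qform.
have -> : bform P (delta_mx j 0) (x - c) = ((x - c)^T *m P^T) 0 j.
  by rewrite /bform trmx_delta -mulmxA -rowE mxE -trmx_mul [RHS]mxE.
have -> : bform P (x - c) (delta_mx j 0) = ((x - c)^T *m P) 0 j.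
  by rewrite /bform -colE mxE.
by rewrite mulmxDr [RHS]mxE addrC.
Qed.

Lemma gradient_qform_mul (P : 'M[R]_n) (c x v : 'cV[R]_n) :
  (gradient (fun x => qform P (x - c)) x *m v) 0 0 =
  bform P v (x - c) + bform P (x - c) v.
Proof.
rewrite gradient_qform mulmxDr mulmxDl mx11D addrC; congr (_ + _).
exact: bform_trmx.
Qed.

Lemma C1_space_qform (P : 'M[R]_n) (c : 'cV[R]_n) :
  C1_space (fun x => qform P (x - c)).
Proof.
split=> [x|x].
  have -> : (fun x => qform P (x - c)) =
      \sum_(i < n) \sum_(j < n) ((fun x : 'cV[R]_n => x j 0 - c j 0) * cst (P j i) *
        (fun x : 'cV[R]_n => x i 0 - c i 0)).
    apply/funext => y; rewrite /qform mxE fct_sumE; apply: eq_bigr => i _.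
    by rewrite mxE fct_sumE big_distrl/=; apply: eq_bigr => j _; rewrite !mxE.
  have dc i : differentiable (fun x : 'cV[R]_n => x i 0 - c i 0) x.
    by apply: differentiableB => //; exact: differentiable_coord.
  apply: differentiable_sum => i; apply: differentiable_sum => j.
  apply: differentiableM; last exact: dc.
  by apply: differentiableM; [exact: dc|exact: differentiable_cst].
suff h (y : 'cV[R]_n) : (fun y => (y - c)^T *m (P + P^T)) @ y --> (y - c)^T *m (P + P^T).
  have -> : gradient (fun x => qform P (x - c)) = fun y => (y - c)^T *m (P + P^T).
    by apply/funext => y; exact: gradient_qform.
  exact: h.
have yT := @cvg_trmx R _ (nbhs y) (nbhs_filter y) _ _ (fun z : 'cV[R]_n => z - c) (y - c)
  (@cvg_subr_cst R 'cV[R]_n c y).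
exact: (@cvg_mulmx R _ (nbhs y) (nbhs_filter y) _ _ _ _ (fun=> P + P^T) _ _ yT (cvg_cst _)).
Qed.

End Estimate.

(** * Piecewise polynomial fields: bounds uniform off the break points *)

Section PolynomialField.
Context {R : realType} (n : nat).
Implicit Types (f : R -> 'cV[R]_n -> 'cV[R]_n).

Definition tame_piece f (c d : R) : Prop :=
  exists G J, tame_field G J /\ forall t, t \in `]c, d[ -> f t = G t.

Lemma sub_itvoo (c d c' d' t : R) : c <= c' -> d' <= d -> t \in `]c', d'[ -> t \in `]c, d[.
Proof.
rewrite !in_itv/= => cc' d'd /andP[ct td].
by rewrite (le_lt_trans cc' ct) (lt_le_trans td d'd).
Qed.

Lemma piecewise_polynomial_tame (a b : R) f :
  piecewise_polynomial a b f -> piecewise a b (tame_piece f).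
Proof.
move=> [_]; apply: piecewise_impl => c d [p hp].
have [G [J [GJ GE]]] := tame_field_poly p.
exists G, J; split=> // t tcd; apply/funext => x; apply/matrixP => i j.
by rewrite ord1 GE hp.
Qed.

Lemma piecewise_polynomial_taylor (a b : R) f : piecewise_polynomial a b f ->
  forall M : R, exists K (S : seq R), 0 <= K /\
    forall t, t \in `]a, b[ -> t \notin S ->
    forall x y, `|x| <= M -> `|y| <= M ->
      `|jacobian_cv (f t) x| <= K /\
      `|f t y - f t x - jacobian_cv (f t) x *m (y - x)| <= K * `|y - x| ^+ 2.
Proof.
move=> /piecewise_polynomial_tame hf M.
pose B (K : R) (c d : R) := forall t, t \in `]c, d[ ->
    forall x y : 'cV[R]_n, `|x| <= M -> `|y| <= M ->
      `|jacobian_cv (f t) x| <= `|K| /\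
      `|f t y - f t x - jacobian_cv (f t) x *m (y - x)| <= `|K| * `|y - x| ^+ 2.
pose B' (K c d : R) := 0 <= K /\ B K c d.
have [||K hK] := @piecewise_uniform R a b B'.
- move=> k k' c d kk' [k0 hB]; split; first exact: le_trans kk'.
  have kk : `|k| <= `|k'| by rewrite !ger0_norm// (le_trans k0).
  move=> t tcd x y xM yM; have [h1 h2] := hB t tcd x y xM yM; split.
    exact: le_trans kk.
  by apply: le_trans h2 _; rewrite ler_wpM2r// exprn_ge0.
- apply: piecewise_impl hf => c d [G [J [GJ GE]]].
  (* This radius bounds both the times of the piece and the states. *)
  have [K K0 hK] := tame_field_taylor GJ (`|c| + `|d| + `|M|).
  exists K; split=> // t tcd x y xM yM.
  rewrite GE// (tame_field_jacobian _ _ GJ) ger0_norm//.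
  have tM : `|t| <= `|c| + `|d| + `|M|.
    apply: (@le_trans _ _ (`|c| + `|d|)); last by rewrite lerDl.
    have ttcd : t \in `[c, d] by move: tcd; rewrite !in_itv/= => /andP[/ltW-> /ltW->].
    rewrite -[t](clampE ttcd); apply: clamp_norm.
    by move: ttcd; rewrite in_itv/= => /andP[]; exact: le_trans.
  have MM : M <= `|c| + `|d| + `|M|.
    by apply: le_trans (ler_norm M) _; rewrite lerDr addr_ge0.
  by have [_ ? ?] := hK t x y tM (le_trans xM MM) (le_trans yM MM).
have [S hS] : exists S : seq R, forall t, t \in `]a, b[ -> t \notin S ->
    forall x y : 'cV[R]_n, `|x| <= M -> `|y| <= M ->
      `|jacobian_cv (f t) x| <= `|K| /\
      `|f t y - f t x - jacobian_cv (f t) x *m (y - x)| <= `|K| * `|y - x| ^+ 2.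
  by apply: piecewise_sub_off; apply: piecewise_impl hK => c d [].
by exists `|K|, S; split.
Qed.

Lemma tame_piece_sub f (c d c' d' : R) :
  c <= c' -> c' < d' -> d' <= d -> tame_piece f c d -> tame_piece f c' d'.
Proof.
move=> cc' _ d'd [G [J [GJ GE]]]; exists G, J; split=> // t tcd.
by apply: GE; exact: sub_itvoo tcd.
Qed.

Lemma C1_piece_sub (W : normedModType R) (g : R -> W) (c d c' d' : R) :
  c <= c' -> c' < d' -> d' <= d -> C1_piece g c d -> C1_piece g c' d'.
Proof.
move=> cc' _ d'd [dg dgc hg]; exists dg; first exact: within_sub dgc.
by move=> t tcd; apply: hg; exact: sub_itvoo tcd.
Qed.

End PolynomialField.

(** * The tube V <= 1 *)

Section Tube.
Context {R : realType} (n : nat).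
Implicit Types (P : R -> 'M[R]_n) (x y : R -> 'cV[R]_n).

(** Equal to 1 at [b], so the final form is unchanged, with constant logarithmic derivative - c / (b
    - a). *)
Definition weight (c a b t : R) : R := expR (c * ((b - t) / (b - a))).

Definition tube (c a b : R) P x (t : R) (z : 'cV[R]_n) : R :=
  qform (weight c a b t *: P t) (z - x t).

Lemma is_derive_weight (c a b t : R) :
  is_derive t 1 (weight c a b) (- (c / (b - a)) * weight c a b t).
Proof.
have -> : weight c a b = fun s => expR (- (c / (b - a)) * (s - b)).
  by apply/funext => s; rewrite /weight; congr expR; ring.
exact: is_derive_expRM.
Qed.

Lemma continuous_weight (c a b : R) : continuous (weight c a b).
Proof.
move=> t; apply/differentiable_continuous/derivable1_diffP.
by have [] := is_derive_weight c a b t.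
Qed.

Lemma is_derive_scale_mx m p (e : R -> R) (M : R -> 'M[R]_(m, p)) (t de : R) dM :
  is_derive t 1 e de -> is_derive t 1 M dM ->
  is_derive t 1 (fun s => e s *: M s) (de *: M t + e t *: dM).
Proof.
move=> he /is_derive_mxP hM; apply/is_derive_mxP => i j.
have -> : (fun s => (e s *: M s) i j) = e * (fun s => M s i j).
  by apply/funext => s; rewrite mxE.
have h := is_deriveM he (hM i j).
by apply: is_derive_eq h _; rewrite !mxE /GRing.scale/= addrC [M t i j * _]mulrC.
Qed.

(** Time derivative of V when the displacement z from the nominal solution moves with velocity [w].
    Leaving [w] free covers both the rate along solutions, w = y' - x', and the partial derivative
    in time, w = - x'. *)
Definition tube_rate (c a b t : R) (P dP : 'M[R]_n) (z w : 'cV[R]_n) : R :=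
  bform (weight c a b t *: P) w z +
  bform ((- (c / (b - a)) * weight c a b t) *: P + weight c a b t *: dP) z z +
  bform (weight c a b t *: P) z w.

Lemma is_derive_tube (c a b t : R) P x y dP dx dy :
  is_derive t 1 P dP -> is_derive t 1 x dx -> is_derive t 1 y dy ->
  is_derive t (1 : R) (fun s => tube c a b P x s (y s))
    (tube_rate c a b t (P t) dP (y t - x t) (dy - dx)).
Proof.
move=> hP hx hy.
exact: is_derive_qform (is_derive_scale_mx (is_derive_weight c a b t) hP) (is_deriveB hy hx).
Qed.

(** For v = f and w = - x' this separates dV/dx f from dV/dt. *)
Lemma tube_rateD (c a b t : R) (P dP : 'M[R]_n) (z v w : 'cV[R]_n) :
  tube_rate c a b t P dP z (v + w) =
  bform (weight c a b t *: P) v z + bform (weight c a b t *: P) z v +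
  tube_rate c a b t P dP z w.
Proof. by rewrite /tube_rate bformDl bformDr; ring. Qed.

Lemma cvg_scale_mx T (F : set_system T) {FF : Filter F} m p (e : T -> R)
    (M : T -> 'M[R]_(m, p)) (e' : R) (M' : 'M[R]_(m, p)) :
  e @ F --> e' -> M @ F --> M' -> (fun s => e s *: M s) @ F --> e' *: M'.
Proof. by move=> he hM; exact: cvgZ. Qed.

Lemma cvg_bform T (F : set_system T) {FF : Filter F} (P : T -> 'M[R]_n)
    (z w : T -> 'cV[R]_n) (P' : 'M[R]_n) (z' w' : 'cV[R]_n) :
  P @ F --> P' -> z @ F --> z' -> w @ F --> w' ->
  (fun s => bform (P s) (z s) (w s)) @ F --> bform P' z' w'.
Proof.
move=> hP hz hw; apply: cvg_mx_entry; apply: cvg_mulmx => //.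
by apply: cvg_mulmx => //; exact: cvg_trmx.
Qed.

Lemma tube_within (c a b d e : R) P x y :
  {within `[d, e], continuous P} -> {within `[d, e], continuous x} ->
  {within `[d, e], continuous y} ->
  {within `[d, e], continuous (fun t => tube c a b P x t (y t))}.
Proof.
move=> Pc xc yc t; apply: cvg_qform.
  apply: cvg_scale_mx; last exact: Pc.
  by apply: continuous_subspaceT; exact: continuous_weight.
by apply: cvgB; [exact: yc|exact: xc].
Qed.

Lemma tube_C1_piece (c a b d e : R) P x (z : 'cV[R]_n) :
  {within `[d, e], continuous P} -> {within `[d, e], continuous x} ->
  C1_piece P d e -> C1_piece x d e -> C1_piece (fun t => tube c a b P x t z) d e.
Proof.
move=> Pc xc [dP dPc hP] [dx dxc hx].
exists (fun t => tube_rate c a b t (P t) (dP t) (z - x t) (0 - dx t)); last first.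
  move=> t tde; exact: is_derive_tube (hP t tde) (hx t tde) (is_derive_cst z t 1).
have wc : {within `[d, e], continuous (weight c a b)}.
  by apply: continuous_subspaceT; exact: continuous_weight.
have zc : {within `[d, e], continuous (fun t => z - x t)}.
  by move=> t; apply: cvgB; [exact: cvg_cst|exact: xc].
have dc : {within `[d, e], continuous (fun t => 0 - dx t)}.
  by move=> t; apply: cvgB; [exact: cvg_cst|exact: dxc].
have wP : {within `[d, e], continuous (fun t => weight c a b t *: P t)}.
  by move=> t; apply: cvg_scale_mx; [exact: wc|exact: Pc].
move=> t; apply: cvgD; first apply: cvgD.
- by apply: cvg_bform; [exact: wP|exact: dc|exact: zc].
- apply: cvg_bform; [|exact: zc|exact: zc].
  apply: cvgD; last by apply: cvg_scale_mx; [exact: wc|exact: dPc].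
  apply: cvg_scale_mx; last exact: Pc.
  by apply: cvgM; [exact: cvg_cst|exact: wc].
- by apply: cvg_bform; [exact: wP|exact: zc|exact: dc].
Qed.

Lemma tube_ge (c a b m t : R) P x z : a < b -> 0 <= c -> t <= b -> 0 <= m ->
  m * `|z - x t| ^+ 2 <= qform (P t) (z - x t) ->
  m * `|z - x t| ^+ 2 <= tube c a b P x t z.
Proof.
move=> ab c0 tb m0 h.
have w1 : 1 <= weight c a b t.
  rewrite /weight -expR0 ler_expR mulr_ge0// divr_ge0 ?subr_ge0//.
  exact: ltW.
rewrite /tube [qform _ _]bform_mxZ; apply: (le_trans h); apply: ler_peMl => //.
by apply: le_trans h; rewrite mulr_ge0// exprn_ge0.
Qed.

End Tube.

(** * Contracting tubes: invariance, existence of solutions, one-sided decrease *)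

Section ContractingTube.
Context {R : realType} (n : nat).
Implicit Types (f : R -> 'cV[R]_n -> 'cV[R]_n) (P A Q : R -> 'M[R]_n)
  (x y : R -> 'cV[R]_n).

Lemma ode_solution_off (W : normedModType R) (F : R -> W -> W) (a b : R) (y : R -> W) :
  ode_solution F a b y ->
  exists S : seq R, forall t, t \in `]a, b[ -> t \notin S -> is_derive t 1 y (F t (y t)).
Proof. by move=> [_]; exact: piecewise_sub_off. Qed.

Lemma linear_flow_exists (S : seq R) (a b : R) f A x : {within `[a, b], continuous x} ->
  off S a b (tame_piece f) ->
  (forall t, t \in `[a, b] -> A t = jacobian_cv (f t) (x t)) ->
  forall s z, s \in `[a, b] -> exists y,
    [/\ continuous y, y s = z & exists S' : seq R, forall t, t \in `]s, b[ -> t \notin S' ->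
     is_derive t 1 y (A t *m y t)].
Proof.
move=> xc fS AE s z; rewrite in_itv/= => /andP[as_ sb].
have [y [yc ys yd]] : exists y, [/\ continuous y, y s = z &
    piecewise s b (solution_piece (fun t w => A t *m w) y)].
  apply: ode_exists; apply: (off_piecewise sb).
  move=> c d sc cd db Scd.
  have [G [J [GJ GE]]] := fS c d (le_trans as_ sc) cd db Scd.
  exists (fun t w => J (clamp c d t) (x (clamp c d t)) *m w).
    apply: (regular_linear (ltW cd) GJ).
    exact: within_sub (le_trans as_ sc) db xc.
  move=> t tcd w; have /andP[ct td] : c < t < d by move: tcd; rewrite in_itv.
  rewrite clampE ?in_itv/= ?(ltW ct) ?(ltW td)//.
  rewrite AE; first by rewrite GE// (tame_field_jacobian _ _ GJ).
  by rewrite in_itv/= (le_trans as_ (le_trans sc (ltW ct))) (le_trans (ltW td) db).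
exists y; split=> //.
by apply: piecewise_sub_off; apply: piecewise_impl yd => c d [dy _ hdy] t /hdy[h <-].
Qed.

(* The rate is bounded on a band around V = 1, and not only there, so that the bound
   survives one-sided limits in time and drives the invariance argument. *)
Definition contracting_tube (c m a b : R) (S : seq R) f P x : Prop :=
  [/\ [/\ a < b, 0 < m & 0 < c],
      {within `[a, b], continuous P} /\ {within `[a, b], continuous x},
      forall t z, t \in `[a, b] -> m * `|z - x t| ^+ 2 <= tube c a b P x t z,
      off S a b (fun d e => [/\ C1_piece P d e, C1_piece x d e & tame_piece f d e]) &
      forall t, t \in `]a, b[ -> t \notin S -> is_derive t 1 x (f t (x t)) /\
       exists2 dP, is_derive t 1 P dP &
        forall z, 2^-1 <= tube c a b P x t z <= 2 ->
         tube_rate c a b t (P t) dP (z - x t) (f t z - f t (x t)) <= -1].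

Lemma tube_dist (c m a b : R) (S : seq R) f P x t z :
  contracting_tube c m a b S f P x -> t \in `[a, b] -> tube c a b P x t z <= 2 ->
  `|z - x t| <= Num.sqrt (2 / m).
Proof.
move=> [[_ m0 _] _ h _ _] tab V2.
rewrite -(ler_pXn2r (n := 2))// ?nnegrE ?sqrtr_ge0// sqr_sqrtr ?divr_ge0 ?(ltW m0)//.
by rewrite ler_pdivlMr// mulrC (le_trans (h t z tab)).
Qed.

(** The barrier at level 1 with band ]1, 2[. The equation is asked of [y] only while V <= 2, so that
    the lemma also applies to solutions of the truncated field. *)
Lemma tube_invariant (c m a b s : R) (S S' : seq R) f P x y :
  contracting_tube c m a b S f P x -> a <= s -> s <= b ->
  {within `[s, b], continuous y} ->
  (forall t, t \in `]s, b[ -> t \notin S' -> tube c a b P x t (y t) <= 2 ->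
     is_derive t 1 y (f t (y t))) ->
  tube c a b P x s (y s) <= 1 ->
  forall t, t \in `[s, b] -> tube c a b P x t (y t) <= 1.
Proof.
move=> [_ [Pc xc] _ _ hS] as_ sb yc yd ys.
apply: (@barrier R (S ++ S') s b 1 2 (fun t => tube c a b P x t (y t))) => //.
- by rewrite ltr1n.
- by apply: tube_within => //;
    [exact: within_sub as_ (lexx b) Pc|exact: within_sub as_ (lexx b) xc].
- move=> t tsb; rewrite mem_cat negb_or => /andP[tS tS'] /andP[V1 V2].
  have tab : t \in `]a, b[ by exact: sub_itvoo tsb.
  have [dx [dP hP rate]] := hS t tab tS.
  have dy := yd t tsb tS' (ltW V2).
  eexists; first exact: is_derive_tube hP dx dy.
  have := rate (y t); rewrite (ltW V2) andbT => h.
  by apply: (le_trans (h _)); lra.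
Qed.

Lemma tube_solution_exists (c m a b s : R) (S : seq R) f P x z :
  contracting_tube c m a b S f P x -> a <= s -> s <= b ->
  tube c a b P x s z <= 1 ->
  exists2 y, ode_solution f s b y & y s = z.
Proof.
move=> ct as_ sb Vs; have [_ [Pc xc] _ fS _] := ct.
have [X X0 hX] := within_continuous_bounded xc.
(* Every point with V <= 2 has norm at most [M], so truncating at [M] changes nothing there. *)
pose M := X + Num.sqrt (2 / m).
have M0 : 0 <= M by rewrite addr_ge0 ?sqrtr_ge0// ltW.
pose F t w := f t (clamp_mx M w).
have FE t w : t \in `[a, b] -> tube c a b P x t w <= 2 -> F t w = f t w.
  move=> tab V2; rewrite /F clamp_mxE// -[w](subrK (x t)).
  apply: (le_trans (ler_normD _ _)); rewrite /M addrC; apply: lerD; first exact: hX.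
  exact: tube_dist ct tab V2.
have [y [yc ys yp]] : exists y, [/\ continuous y, y s = z & piecewise s b (solution_piece F y)].
  apply: ode_exists; apply: (off_piecewise sb) => d e sd de eb Sde.
  have [_ _ [G [J [GJ GE]]]] := fS d e (le_trans as_ sd) de eb Sde.
  exists (fun t w => G (clamp d e t) (clamp_mx M w)).
    exact: regular_clamped (ltW de) M0 GJ.
  move=> t tde w; rewrite /F GE// clampE//.
  by move: tde; rewrite !in_itv/= => /andP[/ltW-> /ltW->].
have ode := solution_piece_ode yc yp.
have sub t : t \in `]s, b[ -> t \in `[a, b].
  by rewrite !in_itv/= => /andP[st /ltW->]; rewrite (le_trans as_ (ltW st)).
(* Invariance is proved for the truncated solution first; only then does [y] turn out to solve the
   original equation. *)
have inv t : t \in `[s, b] -> tube c a b P x t (y t) <= 1.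
  have [S' hS'] := ode_solution_off ode.
  apply: (tube_invariant (S' := S') ct as_ sb); last by rewrite ys.
    exact: continuous_subspaceT.
  by move=> r rsb rS' V2; rewrite -FE//; [exact: hS'|exact: sub].
have [S' hS'] := ode_solution_off ode.
exists y => //; split; first by case: ode.
apply: (off_piecewise (S := S') sb) => d e sd de eb Sde t tde.
have tsb : t \in `]s, b[ by exact: sub_itvoo tde.
have tS' : t \notin S' by apply/negP => /Sde; rewrite tde.
rewrite -FE; [exact: hS'|exact: sub|].
apply: (@le_trans _ _ 1); last by rewrite ler1n.
by apply: inv; move: tsb; rewrite !in_itv/= => /andP[/ltW-> /ltW->].
Qed.

Lemma tube_funnel (c m a b t0 : R) (S : seq R) f P x :
  contracting_tube c m a b S f P x -> t0 <= a ->
  funnel t0 b f [set z : R * 'cV[R]_n | z.1 \in `[a, b] /\ tube c a b P x z.1 z.2 <= 1].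
Proof.
move=> ct ta; split=> [t z [/=]|s xs [/=]].
  by rewrite !in_itv/= => /andP[/(le_trans ta)-> ->].
rewrite in_itv/= => /andP[as_ sb] Vs; split; first exact: tube_solution_exists ct as_ sb Vs.
move=> y ode ys t tsb /=; split.
  by move: tsb; rewrite !in_itv/= => /andP[/(le_trans as_)-> ->].
have [S' hS'] := ode_solution_off ode; have [[yc _] _] := ode.
apply: (tube_invariant (S' := S') ct as_ sb) => //; last by rewrite ys.
by move=> r rsb rS' _; exact: hS'.
Qed.

(** Stated for a filter [H] so as to serve both sides of [t]. A nonnegative limit would contradict
    the uniform bound -1. *)
Lemma one_sided_decrease_tube (c a b t l : R) (w : 'cV[R]_n) (dV : R -> R) f P x z
    (H : set_system R) : ProperFilter H ->
  P @ H --> P t -> x @ H --> x t -> weight c a b @ H --> weight c a b t ->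
  f^~ z @ H --> w -> dV @ H --> l ->
  (fun s => (tube c a b P x s z - tube c a b P x t z) / (s - t)) @ H --> l ->
  (\forall s \near H, bform (weight c a b s *: P s) (f s z) (z - x s) +
     bform (weight c a b s *: P s) (z - x s) (f s z) + dV s <= -1) ->
  one_sided_decrease f (tube c a b P x) t z H.
Proof.
move=> FH Pt xt wt fw dVl dq hn; exists w, l; split=> //.
have -> : tube c a b P x t = fun z => qform (weight c a b t *: P t) (z - x t) by [].
rewrite gradient_qform_mul.
set L := _ + _; rewrite ltNge; apply/negP => L0.
have cv : (fun s => bform (weight c a b s *: P s) (f s z) (z - x s) +
     bform (weight c a b s *: P s) (z - x s) (f s z) + dV s) @ H --> L.
  have wP : (fun s => weight c a b s *: P s) @ H --> weight c a b t *: P t.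
    exact: cvg_scale_mx.
  have zx : (fun s => z - x s) @ H --> z - x t by apply: cvgB => //; exact: cvg_cst.
  apply: cvgD => //; apply: cvgD.
    exact: (cvg_bform wP fw zx).
  exact: (cvg_bform wP zx fw).
have gt : \forall s \near H, -1 < bform (weight c a b s *: P s) (f s z) (z - x s) +
     bform (weight c a b s *: P s) (z - x s) (f s z) + dV s.
  by apply: cvgr_gt cv _ _; exact: lt_le_trans (ltrN10 R) L0.
have [s [h1 h2]] := filter_ex (filterI gt hn).
by move: h1; rewrite ltNge h2.
Qed.

Lemma tube_rate_le (c m a b s l : R) (S : seq R) f P x z :
  contracting_tube c m a b S f P x -> s \in `]a, b[ -> s \notin S ->
  is_derive s (1 : R) (fun s => tube c a b P x s z) l ->
  2^-1 <= tube c a b P x s z <= 2 ->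
  bform (weight c a b s *: P s) (f s z) (z - x s) +
     bform (weight c a b s *: P s) (z - x s) (f s z) + l <= -1.
Proof.
move=> [_ _ _ _ hS] sab sS Vl V12; have [dx [dP hP rate]] := hS s sab sS.
have hV := is_derive_tube c a b hP dx (is_derive_cst z s 1).
(* By uniqueness of the derivative: for fixed [z] the displacement moves with velocity - x'. *)
have -> : l = tube_rate c a b s (P s) dP (z - x s) (0 - f s (x s)).
  by rewrite -(@derive_val _ _ _ _ _ _ _ Vl) (@derive_val _ _ _ _ _ _ _ hV).
rewrite -tube_rateD add0r; exact: rate.
Qed.

Lemma tube_decrease (c m a b : R) (S : seq R) f P x t z :
  contracting_tube c m a b S f P x -> t \in `[a, b] -> tube c a b P x t z = 1 ->
  decrease a b f (tube c a b P x) t z.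
Proof.
move=> ct; rewrite in_itv/= => /andP[a_t tb] V1; have [_ [Pc xc] _ hoff _] := ct.
have wc := @continuous_weight R c a b.
split=> [{}tb|{}a_t].
- have [d0 td0 hd0] := near_right_itv (near_right_notin t S).
  (* On ]t, d[ no time of [S] occurs, so all the data there belong to a single piece. *)
  pose d := Num.min d0 b.
  have td : t < d by rewrite lt_min td0.
  have [dd0 db] : d <= d0 /\ d <= b by rewrite !ge_min !lexx orbT.
  have free r : r \in S -> r \notin `]t, d[.
    move=> rS; apply/negP; rewrite in_itv/= => /andP[tr rd].
    by have := hd0 r; rewrite tr (lt_le_trans rd dd0) rS => /(_ isT).
  have [P1 x1 [G [J [GJ GE]]]] := hoff t d a_t td db free.
  have Pc' := within_sub a_t db Pc; have xc' := within_sub a_t db xc.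
  have Vc' : {within `[t, d], continuous (fun s => tube c a b P x s z)}.
    apply: (@tube_within R n c a b t d P x (fun=> z) Pc' xc') => ?; exact: cvg_cst.
  have [dV dVc hdV] := tube_C1_piece c a b z Pc' xc' P1 x1.
  have [_ PR _] := (continuous_within_itvP _ td).1 Pc'.
  have [_ xR _] := (continuous_within_itvP _ td).1 xc'.
  have [_ VR _] := (continuous_within_itvP _ td).1 Vc'.
  have [_ dVR _] := (continuous_within_itvP _ td).1 dVc.
  (* The polynomial field of the piece is continuous at [t], so [G t z] is the right limit of [f],
     whatever [f t z] is. *)
  have GR : G^~ z @ t^'+ --> G t z.
    apply: cvg_at_right_filter.
    by apply: (tame_field_continuous (s := id) (u := fun=> z) GJ) => s;
      [exact: cvg_id|exact: cvg_cst].
  apply: (@one_sided_decrease_tube c a b t (dV t) (G t z) dV) => //.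
  + exact: cvg_at_right_filter (wc t).
  + apply: cvg_trans GR; apply: near_eq_cvg; near=> s.
    rewrite GE// in_itv/=; apply/andP; split; near: s.
      exact: nbhs_right_gt.
    exact: nbhs_right_lt.
  + exact: right_diff_quotient td Vc' hdV dVR.
  + near=> s.
    have std : s \in `]t, d[.
      rewrite in_itv/=; apply/andP; split; near: s.
        exact: nbhs_right_gt.
      exact: nbhs_right_lt.
    apply: (tube_rate_le ct).
    * exact: sub_itvoo std.
    * by apply/negP => /free; rewrite std.
    * exact: hdV.
    (* V = 1 at time [t] lies strictly inside the band, so V stays in the band shortly after [t]. *)
    * apply/andP; split; near: s.
        by apply: (cvgr_ge _ VR); rewrite V1 invf_lt1// ltr1n.
      by apply: (cvgr_le _ VR); rewrite V1 ltr1n.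
(* Mirror image on the left of [t]. *)
- have [d0 td0 hd0] := near_left_itv (near_left_notin t S).
  pose d := Num.max d0 a.
  have td : d < t by rewrite gt_max td0.
  have [dd0 db] : d0 <= d /\ a <= d by rewrite !le_max !lexx orbT.
  have free r : r \in S -> r \notin `]d, t[.
    move=> rS; apply/negP; rewrite in_itv/= => /andP[tr rd].
    by have := hd0 r; rewrite rd (le_lt_trans dd0 tr) rS => /(_ isT).
  have [P1 x1 [G [J [GJ GE]]]] := hoff d t db td tb free.
  have Pc' := within_sub db tb Pc; have xc' := within_sub db tb xc.
  have Vc' : {within `[d, t], continuous (fun s => tube c a b P x s z)}.
    apply: (@tube_within R n c a b d t P x (fun=> z) Pc' xc') => ?; exact: cvg_cst.
  have [dV dVc hdV] := tube_C1_piece c a b z Pc' xc' P1 x1.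
  have [_ _ PR] := (continuous_within_itvP _ td).1 Pc'.
  have [_ _ xR] := (continuous_within_itvP _ td).1 xc'.
  have [_ _ VR] := (continuous_within_itvP _ td).1 Vc'.
  have [_ _ dVR] := (continuous_within_itvP _ td).1 dVc.
  have GR : G^~ z @ t^'- --> G t z.
    apply: cvg_at_left_filter.
    by apply: (tame_field_continuous (s := id) (u := fun=> z) GJ) => s;
      [exact: cvg_id|exact: cvg_cst].
  apply: (@one_sided_decrease_tube c a b t (dV t) (G t z) dV) => //.
  + exact: cvg_at_left_filter (wc t).
  + apply: cvg_trans GR; apply: near_eq_cvg; near=> s.
    rewrite GE// in_itv/=; apply/andP; split; near: s.
      exact: nbhs_left_gt.
    exact: nbhs_left_lt.
  + exact: left_diff_quotient td Vc' hdV dVR.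
  + near=> s.
    have std : s \in `]d, t[.
      rewrite in_itv/=; apply/andP; split; near: s.
        exact: nbhs_left_gt.
      exact: nbhs_left_lt.
    apply: (tube_rate_le ct).
    * exact: sub_itvoo std.
    * by apply/negP => /free; rewrite std.
    * exact: hdV.
    * apply/andP; split; near: s.
        by apply: (cvgr_ge _ VR); rewrite V1 invf_lt1// ltr1n.
      by apply: (cvgr_le _ VR); rewrite V1 ltr1n.
Unshelve. all: by end_near. Qed.

End ContractingTube.

(** * Choice of the constants and conclusion *)

Lemma contracting_tube_exists (R : realType) (n : nat) (t0 a b : R)
    (f : R -> 'cV[R]_n -> 'cV[R]_n) (x : R -> 'cV[R]_n) (P A Q : R -> 'M[R]_n) :
  t0 <= a -> a < b -> piecewise_polynomial t0 b f -> ode_solution f a b x ->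
  (forall t, t \in `[a, b] -> A t = jacobian_cv (f t) (x t)) ->
  (forall t, t \in `[a, b] -> symposdef (Q t)) ->
  ode_solution (fun t P => - ((A t)^T *m P + P *m A t + Q t)) a b P ->
  symposdef (P b) ->
  exists c m S, contracting_tube c m a b S f P x.
Proof.
move=> t0a ab hf xode AE Qpos Pode Pb.
have [[xc xp] _] := xode; have [[Pc Pp] _] := Pode.
have [S1 hS1] := ode_solution_off xode; have [S2 hS2] := ode_solution_off Pode.
have [S3 hS3] := piecewise_off (@C1_piece_sub _ _ x) xp.
have [S4 hS4] := piecewise_off (@C1_piece_sub _ _ P) Pp.
have [S5 hS5] := piecewise_off (@tame_piece_sub _ _ f) (piecewise_polynomial_tame hf).
have {}hS5 : off S5 a b (tame_piece f) by exact: off_restrict t0a (lexx b) hS5.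
have [X X0 hX] := within_continuous_bounded xc.
have [p p0 hp] := within_continuous_bounded Pc.
have sub t : t \in `]a, b[ -> t \in `[a, b].
  by rewrite !in_itv/= => /andP[/ltW-> /ltW->].
have sub0 t : t \in `]a, b[ -> t \in `]t0, b[ by exact: sub_itvoo.
have Q0 t z : t \in `]a, b[ -> 0 <= qform (Q t) z.
  by move=> /sub/Qpos; exact: symposdef_ge0.
(* Applied along [x] itself, this bounds [A] off a finite list. *)
have [K1 [S6 [K10 hS6]]] := piecewise_polynomial_taylor hf X.
have [m m0 hm] : exists2 m : R, 0 < m &
    forall t z, t \in `[a, b] -> m * `|z| ^+ 2 <= qform (P t) z.
  apply: (@lyapunov_lower R n (S2 ++ S6) a b K1 A Q P) => //; first exact: ltW.
  - by move=> t tab; rewrite mem_cat negb_or => /andP[tS _]; exact: hS2.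
  - move=> t tab; rewrite mem_cat negb_or => /andP[_ tS].
    rewrite AE ?sub//; have xX := hX t (sub t tab).
    by have [] := hS6 t (sub0 t tab) tS _ _ xX xX.
  - by apply: linear_flow_exists hS5 AE; exact: xc.
set rho := Num.sqrt (2 / m).
have rho0 : 0 <= rho by exact: sqrtr_ge0.
(* The ball of radius [X + rho] contains the whole band, whatever c will be. *)
have [K [S7 [K0 hS7]]] := piecewise_polynomial_taylor hf (X + rho).
pose k := 2 * (2 * n%:R ^+ 2 * p * K * rho ^+ 3 + 1).
have k0 : 0 < k.
  by rewrite mulr_gt0// ltr_wpDl// !mulr_ge0// ?exprn_ge0// ltW.
have ba : 0 < b - a by rewrite subr_gt0.
(* Chosen so that the logarithmic derivative of the weight is - k. *)
pose c := (b - a) * k.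
have ck : c / (b - a) = k by rewrite /c mulrAC mulfV ?mul1r// gt_eqF.
exists c, m, (S1 ++ S2 ++ S3 ++ S4 ++ S5 ++ S7); split.
- by split=> //; rewrite mulr_gt0.
- by [].
- move=> t z tab; apply: tube_ge => //; first by rewrite mulr_ge0// ltW.
  + by move: tab; rewrite in_itv/= => /andP[].
  + exact: ltW.
  + exact: hm.
- move=> d e ad de eb Sde; split.
  + by apply: hS4 => // r rS; apply: Sde; rewrite !mem_cat rS !orbT.
  + by apply: hS3 => // r rS; apply: Sde; rewrite !mem_cat rS !orbT.
  + by apply: hS5 => // r rS; apply: Sde; rewrite !mem_cat rS !orbT.
- move=> t tab; rewrite !mem_cat !negb_or => /and5P[tS1 tS2 tS3 tS4 /andP[tS5 tS7]].
  split; first exact: hS1.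
  exists (- ((A t)^T *m P t + P t *m A t + Q t)); first exact: hS2.
  move=> z /andP[V1 V2]; rewrite /tube_rate ck.
  apply: (@bform_estimate R n (P t) (Q t) (A t) (f t z - f t (x t)) (z - x t) m p K k) => //.
  + exact: ltW.
  + rewrite /weight -expR0 ler_expR mulr_ge0//; first by rewrite mulr_ge0// ltW.
    by rewrite divr_ge0 ?(ltW ba)// subr_ge0; move: tab; rewrite in_itv/= => /andP[_ /ltW].
  + by apply: hp; exact: sub.
  + by apply: hm; exact: sub.
  + exact: Q0.
  + move=> zr; rewrite AE ?sub//; have xX := hX t (sub t tab).
    have xM : `|x t| <= X + rho by rewrite (le_trans xX)// lerDl.
    have zM : `|z| <= X + rho.
      rewrite -[z](subrK (x t)) (le_trans (ler_normD _ _))// addrC lerD//.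
    by have [] := hS7 t (sub0 t tab) tS7 _ _ xM zM.
Qed.

Theorem lemma4 (R : realType) (n : nat) (t0 tf : R) (ht0f : t0 < tf)
    (f : R -> 'cV[R]_n -> 'cV[R]_n)
    (hf : piecewise_polynomial t0 tf f)
    (PG : 'M[R]_n) (hPG : symposdef PG)
    (tau : R) (htau : tau \in `[t0, tf[)
    (x0 : R -> 'cV[R]_n) (hx0 : ode_solution f tau tf x0)
    (hxf : (ellipsoid PG 0)° (x0 tf))
    (Pf : 'M[R]_n)
    (hPf : largest_centered_ellipsoid (ellipsoid PG 0) (x0 tf) Pf)
    (A : R -> 'M[R]_n)
    (hA : forall t, t \in `[tau, tf] -> A t = jacobian_cv (f t) (x0 t))
    (Q : R -> 'M[R]_n)
    (hQ : forall t, t \in `[tau, tf] -> symposdef (Q t))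
    (P0 : R -> 'M[R]_n)
    (hP0 : ode_solution
             (fun t P => - ((A t)^T *m P + P *m A t + Q t)) tau tf P0)
    (hP0f : P0 tf = Pf) :
  exists c : R, 0 < c /\
    let P := fun t : R => expR (c * ((tf - t) / (tf - tau))) *: P0 t in
    let V := fun (t : R) (x : 'cV[R]_n) => qform (P t) (x - x0 t) in
    [/\ forall t x, t \in `[tau, tf] -> 0 <= V t x,
        piecewise_C1_time_C1_space tau tf V,
        forall t x, t \in `[tau, tf] -> V t x = 1 -> decrease tau tf f V t x,
        [set x | V tf x <= 1] `<=` ellipsoid PG 0 &
        funnel_into t0 tf f (ellipsoid PG 0)
          [set z : R * 'cV[R]_n | z.1 \in `[tau, tf] /\ V z.1 z.2 <= 1]].
Proof.
have [Pfpos PfG _] := hPf.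
have /andP[t0tau tautf] : t0 <= tau < tf by move: htau; rewrite in_itv.
have Pb : symposdef (P0 tf) by rewrite hP0f.
have [c [m [S ct]]] := contracting_tube_exists t0tau tautf hf hx0 hA hQ hP0 Pb.
have [[_ m0 c0] [Pc xc] Vge hoff _] := ct.
exists c; split=> // P V; rewrite -/(tube c tau tf P0 x0) in V *.
have VE : V = tube c tau tf P0 x0 by [].
have sublevel : [set x | V tf x <= 1] `<=` ellipsoid PG 0.
  (* At [tf] the weight is 1 and V is the form of [Pf], whose ellipsoid lies in the goal set. *)
  move=> x /=; rewrite VE /tube /weight subrr mul0r mulr0 expR0 scale1r hP0f.
  by move=> h; apply: PfG.
split=> //.
- move=> t x tab; apply: le_trans (Vge t x tab).
  by rewrite mulr_ge0 ?exprn_ge0// ltW.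
- split=> [x||t _].
  + by apply: (tube_within (y := fun=> x)) => // ?; exact: cvg_cst.
  + apply: (off_piecewise (S := S) (ltW tautf)) => d e ad de eb Sde x.
    have [P1 x1 _] := hoff d e ad de eb Sde.
    by apply: tube_C1_piece => //; [exact: within_sub Pc|exact: within_sub xc].
  + exact: C1_space_qform.
- by move=> t x tab V1; exact: tube_decrease ct tab V1.
- split; first exact: tube_funnel ct t0tau.
  by move=> x /= [_]; exact: sublevel.
Qed.
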